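(* Let $\delta\in(0,1)$. Let $\omega=(\omega_x)_{x\in\mathbb Z}$ be an i.i.d. random environment satisfying $\mathbb E[\log\rho_0]=0$, $\operatorname{Var}(\log\rho_0)>0$ (where $\rho_0=\frac{1-\omega_0}{\omega_0}$), and $\mathbb P(\varepsilon\le\omega_0\le 1-\varepsilon)=1$ for some $\varepsilon\in(0,\tfrac12)$. Let $\nu$ be a probability distribution on $\mathbb Z$ with zero expectation such that $(\nu^{*n}(A_n\,\cdot))_n$ converges to a $\beta$-stable distribution with $\beta\in(1,2]$, for some suitable increasing sequence $(A_n)_n$ of positive real numbers. Assume that, given $\omega$, $(M_n)_{n\ge0}$ is a Markov chain with values in $\mathbb Z^2$ such that $$P_\omega(M_0=(0,0))=1,$$ $$P_\omega\big(M_{n+1}=(x+1,y)\mid M_n=(x,y)\big)=\delta\,\omega_x,$$ $$P_\omega\big(M_{n+1}=(x-1,y)\mid M_n=(x,y)\big)=\delta\,(1-\omega_x),$$ $$P_\omega\big(M_{n+1}=(x,y+z)\mid M_n=(x,y)\big)=(1-\delta)\,\nu(z)\qquad(z\in\mathbb Z).$$ Then, for $\mathbb P$-a.e. environment $\omega$, $(M_n)_{n\ge0}$ is recurrent.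
   Context: $\omega=(\omega_x)_{x\in\mathbb Z}$ is a sequence of i.i.d. random variables with values in $(0,1)$ defined on a probability space $(\Omega,\mathcal F,\mathbb P)$; $\mathbb E$ and $\operatorname{Var}$ refer to $\mathbb P$. $\nu^{*n}(A_n\,\cdot)$ denotes the distribution of $(Z_1+\dots+Z_n)/A_n$, where $Z_1,\dots,Z_n$ are i.i.d. with distribution $\nu$; convergence is weak convergence. A $\beta$-stable distribution is understood to be non-degenerate. Recurrent means that, $P_\omega$-almost surely, the chain returns to its starting point $(0,0)$ infinitely often. *)

(* Defs.v *)
From HB Require Import structures.
From mathcomp Require Import all_boot all_order all_algebra finmap.
From mathcomp Require Import all_classical all_reals all_analysis.
From mathcomp Require Import measurable_realfun.

Set Implicit Arguments.
Unset Strict Implicit.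
Unset Printing Implicit Defensive.

Import Order.TTheory GRing.Theory Num.Theory.
Import numFieldNormedType.Exports.

Local Open Scope classical_set_scope.
Local Open Scope ring_scope.

HB.instance Definition _ := isPointed.Build int 0.

HB.instance Definition _ := @isMeasurable.Build default_measure_display
  int discrete_measurable discrete_measurable0
  discrete_measurableC discrete_measurableU.

(* A library measure is a function on all sets, unconstrained on the
   non-measurable ones; laws are therefore compared on measurable sets only. *)
Definition eq_law d (T : measurableType d) (R : realType)
    (mu1 mu2 : probability T R) : Prop :=
  forall B : set T, measurable B -> mu1 B = mu2 B.

Definition mutually_independent d (Omega : measurableType d) (R : realType)
    (P : probability Omega R) (I : choiceType) (X : I -> {RV P >-> R}) : Prop :=
  forall (J : {fset I}) (B : I -> set R), (forall i, measurable (B i)) ->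
    P (\bigcap_(i in [set` J]) (X i @^-1` B i))
    = (\prod_(i <- J) P (X i @^-1` B i))%E.

Definition identically_distributed d (Omega : measurableType d) (R : realType)
    (P : probability Omega R) (I : Type) (X : I -> {RV P >-> R}) : Prop :=
  forall i j : I, eq_law (distribution P (X i)) (distribution P (X j)).

Definition iid d (Omega : measurableType d) (R : realType)
    (P : probability Omega R) (I : choiceType) (X : I -> {RV P >-> R}) : Prop :=
  mutually_independent X /\ identically_distributed X.

Definition rho d (Omega : measurableType d) (R : realType)
    (P : probability Omega R) (omega : int -> {RV P >-> R}) (x : int)
    (w : Omega) : R :=
  (1 - omega x w) / omega x w.

Section laws_on_R.
Context {R : realType}.

Definition intR (z : int) : R := z%:~R.

Lemma measurable_intR : measurable_fun [set: int] intR.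
Proof. by []. Qed.

HB.instance Definition _ := isMeasurableFun.Build _ _ _ _ intR measurable_intR.

Definition affine (a b x : R) : R := a * x + b.

Lemma measurable_affine (a b : R) : measurable_fun [set: R] (affine a b).
Proof. by apply: measurable_funD => //; exact: measurable_funM. Qed.

HB.instance Definition _ (a b : R) :=
  isMeasurableFun.Build _ _ _ _ (affine a b) (measurable_affine a b).

Definition addR2 (xy : R * R) : R := xy.1 + xy.2.

Lemma measurable_addR2 : measurable_fun [set: R * R] addR2.
Proof. exact: measurable_funD. Qed.

HB.instance Definition _ :=
  isMeasurableFun.Build _ _ _ _ addR2 measurable_addR2.

(* The law of a * X + b when X has law mu. *)
Definition affine_law (a b : R) (mu : probability R R) : probability R R :=
  distribution mu (affine a b).

(* The law of X + Y for X, Y independent with laws mu1 and mu2. *)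
Definition convolution (mu1 mu2 : probability R R) : probability R R :=
  distribution (mu1 \x mu2)%E addR2.

Fixpoint convolution_pow (mu : probability R R) (n : nat) : probability R R :=
  if n is m.+1 then convolution (convolution_pow mu m) mu else dirac (0 : R).

Definition real_law (nu : probability int R) : probability R R :=
  distribution nu intR.

(* The law nu^{*n}(a .) of (Z_1 + ... + Z_n) / a, the Z_i being i.i.d. with
   law nu. *)
Definition normalized_sum_law (nu : probability int R) (n : nat) (a : R) :
    probability R R :=
  affine_law a^-1 0 (convolution_pow (real_law nu) n).

Definition weak_cvg (mu_ : nat -> probability R R) (mu : probability R R) :
    Prop :=
  forall f : R -> R, continuous f -> bounded_fun f ->
    ((fun n => \int[mu_ n]_x (f x)%:E) @ \oo --> \int[mu]_x (f x)%:E)%E.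

Definition nondegenerate (mu : probability R R) : Prop :=
  forall c : R, mu [set c] != 1%E.

(* beta-stability in the broad sense (centering allowed): for X, Y independent
   with law mu, a X + b Y has the law of (a^beta + b^beta)^(1/beta) X + c. *)
Definition stable (beta : R) (mu : probability R R) : Prop :=
  nondegenerate mu /\
  forall a b : R, 0 < a -> 0 < b -> exists c : R,
    eq_law (convolution (affine_law a 0 mu) (affine_law b 0 mu))
           (affine_law ((a `^ beta + b `^ beta) `^ beta^-1) c mu).

End laws_on_R.

(* Junk value 0 when P B = 0. *)
Definition cond_prob d (T : measurableType d) (R : realType)
    (P : probability T R) (A B : set T) : R :=
  fine (P (A `&` B)) / fine (P B).

Definition markov_chain d d' (T : measurableType d) (S : measurableType d')
    (R : realType) (P : probability T R) (M : nat -> {mfun T >-> S}) : Prop :=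
  forall (n : nat) (s : nat -> S),
    let past := [set t | forall k, (k <= n)%N -> M k t = s k] in
    (0 < P past)%E ->
    cond_prob P [set t | M n.+1 t = s n.+1] past =
    cond_prob P [set t | M n.+1 t = s n.+1] [set t | M n t = s n].

(* Conditional probabilities given null events are left unconstrained. *)
Definition transition_prob d d' (T : measurableType d) (S : measurableType d')
    (R : realType) (P : probability T R) (M : nat -> {mfun T >-> S})
    (s s' : S) (p : R) : Prop :=
  forall n : nat, (0 < P [set t | M n t = s])%E ->
    cond_prob P [set t | M n.+1 t = s'] [set t | M n t = s] = p.

Definition recurrent_at d d' (T : measurableType d) (S : measurableType d')
    (R : realType) (P : probability T R) (M : nat -> {mfun T >-> S})
    (s0 : S) : Prop :=
  {ae P, forall t, forall N : nat, exists2 n, (N <= n)%N & M n t = s0}.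

(* Main.v *)
Require Import Defs.
From HB Require Import structures.
From mathcomp Require Import all_boot all_order all_algebra finmap.
From mathcomp Require Import all_classical all_reals all_analysis.
From mathcomp Require Import measurable_realfun.
From mathcomp Require Import ring lra zify.

Set Implicit Arguments.
Unset Strict Implicit.
Unset Printing Implicit Defensive.

Import Order.TTheory GRing.Theory Num.Theory.
Import numFieldNormedType.Exports.

Local Open Scope classical_set_scope.
Local Open Scope ring_scope.

(** The proof shows that the Green function [green N], the expected number of
    visits to the origin before time [N], is unbounded for almost every
    environment. That suffices ([green_unbounded_recurrent]): on the event
    that some visit is the last one the chain escapes forever, and the Markov
    property gives [green N * escape N origin <= 1].

    In a fixed environment [u], let [potential u] be the function vanishing at
    0 whose increments are the log-odds [ln ((1 - u x) / u x)]. The measure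
    [pi x = exp (- potential u x) / u x] is reversible for the horizontal
    motion, and the vertical motion is translation invariant. Hence the
    expected number of visits to [(x, y)], divided by [pi x], satisfies an
    averaging recursion with a source at the origin only, so it is largest at
    the origin ([visits_le]). If the chain is in the box [[-b, c] x [-m, m]]
    with probability at least 1/4 at every time before [N], summing over the
    box gives
      [N / 4 <= (b + c + 1) (2 m + 1) (max pi / pi 0) green N]
    ([green_lower]). Three facts make the right-hand factor [o(N)].

    - Vertically, the normalizations of a law attracted by a [beta]-stable law
      satisfy [A (2 n) <= r A n] eventually, for every [r > 2^(1/beta)]; since
      [beta > 1] one can take [r < 2] ([normalization_double]). So before time
      [N = n1 2^j] the vertical coordinate stays below [m ~ C r^j] with
      probability at least 3/4 at each time ([vertical_scale],
      [vertical_spread]).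
    - Horizontally, the chain can only leave [[-b, c]] through an endpoint, at
      a cost [N pi c / pi 0] or [N pi (-b) / pi 0] ([beyond_le]). This is small
      if the potential is at least [j] at both endpoints, because [2 < e].
    - The potential of almost every environment has, for every [a > 0] and for
      infinitely many [j], barriers of height [j] at distances [b, c] that are
      polynomial in [j], with no well deeper than [a j] in between
      ([valleys]). Indeed it is a random walk with centred bounded increments,
      and gambler's ruin ([exit_above]) bounds from below, uniformly, the
      probability that a fresh block of [j^4] sites on each side climbs to
      [2 j] before going down by [a j / 2]; blocks on disjoint sites are
      independent.

    Along such [j] the Green function is at least of order
    [(2 / (r exp a))^j / j^4], which diverges when [a] is so small that
    [r exp a < 2]. *)

(** * Measures on countable sets *)

Lemma measurable_int2 (B : set (int * int)) : measurable B.
Proof.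
apply: countable_measurable; last exact: countableP.
case=> x y; rewrite (_ : [set _] = [set x] `*` [set y]); first exact: measurableX.
by apply/seteqP; split => [_ ->|[a b] [/= -> ->]].
Qed.

Lemma measurable_fun_int2 d (T : measurableType d) (f : int * int -> T) :
  measurable_fun setT f.
Proof. by move=> _ B _; exact: measurable_int2. Qed.

Lemma measurable_fun_int d (T : measurableType d) (f : int -> T) :
  measurable_fun setT f.
Proof. by []. Qed.

Section atoms.
Local Open Scope ereal_scope.
Context {R : realType} {S : countType}.

(** Level sets of a countably valued map, indexed by [nat] so that
    countable additivity over sequences applies. *)
Definition atom d (T : measurableType d) (H : T -> S) (i : nat) : set T :=
  [set t | choice.pickle (H t) = i].

Lemma atomE d (T : measurableType d) (H : T -> S) i s :
  choice.unpickle i = Some s -> atom H i = [set t | H t = s] \/ atom H i = set0.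
Proof.
move=> hs; have [<-|ne] := eqVneq (choice.pickle s) i.
  left; apply/seteqP; split=> t /=; last by rewrite /atom/= => ->.
  exact: (pcan_inj choice.pickleK).
right; apply/seteqP; split => t //= ht; move: ne.
have := choice.pickleK (H t); rewrite /atom/= in ht *; rewrite ht hs => -[->].
by rewrite ht eqxx.
Qed.

Lemma atomP d (T : measurableType d) (H : T -> S) i :
  atom H i = set0 \/ exists s, atom H i = [set t | H t = s].
Proof.
case hs: (choice.unpickle i) => [s|].
  by case: (atomE H hs) => ->; [right; exists s|left].
left; apply/seteqP; split => t //= ht.
by have := choice.pickleK (H t); rewrite ht hs.
Qed.

Lemma measurable_atom d (T : measurableType d) (H : T -> S) i :
  (forall s, measurable [set t | H t = s]) -> measurable (atom H i).
Proof. by move=> mH; case: (atomP H i) => [->|[s ->]]. Qed.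

Lemma trivIset_atom d (T : measurableType d) (H : T -> S) :
  trivIset setT (atom H).
Proof. by move=> i j _ _ [t [<- <-]]. Qed.

Lemma bigcup_atom d (T : measurableType d) (H : T -> S) :
  \bigcup_i atom H i = setT.
Proof. by apply/seteqP; split=> // t _; exists (choice.pickle (H t)). Qed.

Lemma measure_atoms d (T : measurableType d) (m : {measure set T -> \bar R})
    (H : T -> S) (B : set T) :
  (forall s, measurable [set t | H t = s]) -> measurable B ->
  m B = \sum_(0 <= i <oo) m (atom H i `&` B).
Proof.
move=> mH mB; rewrite -{1}(setTI B) -(bigcup_atom H) setI_bigcupl.
apply: measure_semi_bigcup.
- by move=> i; apply: measurableI => //; exact: measurable_atom.
- by apply: trivIset_setIr; exact: trivIset_atom.
- apply: bigcup_measurable => i _.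
  by apply: measurableI => //; exact: measurable_atom.
Qed.

Lemma integral_atoms d (T : measurableType d) (m : {measure set T -> \bar R})
    (H : T -> S) (f : T -> \bar R) :
  (forall s, measurable [set t | H t = s]) -> measurable_fun setT f ->
  (forall t, 0 <= f t) ->
  \int[m]_t f t = \sum_(0 <= i <oo) \int[m]_(t in atom H i) f t.
Proof.
move=> mH mf f0; rewrite -(bigcup_atom H).
apply: ge0_integral_bigcup.
- by move=> i; exact: measurable_atom.
- by rewrite bigcup_atom.
- by move=> x _; exact: f0.
- exact: trivIset_atom.
Qed.

End atoms.

Lemma integral_mrestr d (T : measurableType d) (R : realType)
    (m : {measure set T -> \bar R}) (D : set T) (mD : measurable D)
    (f : T -> \bar R) : measurable_fun setT f -> (forall t, 0 <= f t)%E ->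
  (\int[mrestr m mD]_t f t = \int[m]_(t in D) f t)%E.
Proof.
move=> mf f0; rewrite -(setUv D) ge0_integral_setU//=; last 3 first.
- exact: measurableC.
- by rewrite setUv.
- by apply/disj_setPS; rewrite setICr.
rewrite (eq_measure_integral m); last first.
  by move=> A mA AD; rewrite -[LHS]/(m (A `&` D)) setIidl.
rewrite [X in (_ + X)%E](_ : _ = 0%E) ?adde0//.
rewrite (eq_measure_integral mzero); last first.
  move=> A mA AD; rewrite -[LHS]/(m (A `&` D)) (_ : A `&` D = set0) ?measure0//.
  by rewrite -subset0 => t [] /AD.
by rewrite integral_measure_zero.
Qed.

Lemma integral_probability_cst d (T : measurableType d) (R : realType)
    (P : probability T R) (c : \bar R) : (\int[P]_t c = c)%E.
Proof.
rewrite integral_cst// -[RHS]mule1; congr (_ * _)%E; exact: probability_setT.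
Qed.

(** A measure is determined by its atoms here; equal total masses turn
    domination on points into equality. *)
Lemma eq_measure_on_points d (S : measurableType d) (R : realType)
    (m1 m2 : {measure set S -> \bar R}) (K : countType) (H : S -> K) :
  (forall B : set S, measurable B) -> injective H ->
  (forall s, m2 [set s] <= m1 [set s])%E ->
  (m1 setT <= m2 setT)%E -> (m1 setT < +oo)%E ->
  forall B, m1 B = m2 B.
Proof.
move=> mS injH m21 m12T m1oo.
have le B : (m2 B <= m1 B)%E.
  rewrite (measure_atoms m2 (H := H)) // (measure_atoms m1 (H := H)) //.
  apply: lee_nneseries => // i _; case: (atomP H i) => [->|[k ->]].
    by rewrite set0I !measure0.
  have [[s [Bs <-]]|nex] := pselect (exists s, B s /\ H s = k).
    rewrite (_ : _ `&` _ = [set s]) ?m21//.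
    by apply/seteqP; split => [t [/injH]//|t ->].
  rewrite (_ : _ `&` _ = set0) ?measure0//.
  by rewrite -subset0 => t [/= Htk Bt]; apply: nex; exists t.
move=> B; apply/eqP; rewrite eq_le le andbT.
have fin1 C : m1 C \is a fin_num.
  by rewrite ge0_fin_numE// (le_lt_trans _ m1oo)// le_measure ?inE.
have fin2 C : m2 C \is a fin_num.
  by rewrite ge0_fin_numE// (le_lt_trans (le C))// -ge0_fin_numE.
have := m12T; rewrite -(setUv B) !measureU ?setICr// => h.
have := leeD2l (m1 B) (le (~` B)).
move=> /le_trans/(_ h); rewrite leeD2rE//.
Qed.

(** * One step of the chain *)

Definition origin : int * int := (0, 0).

Definition vert (s : int * int) (z : int) : int * int := (s.1, s.2 + z).

HB.instance Definition _ s :=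
  isMeasurableFun.Build _ _ _ _ (vert s) (measurable_fun_int (vert s)).

Section chain.
Context {R : realType} (delta : R) (nu : probability int R) (u : int -> R).
Context d (T : measurableType d) (P : probability T R).
Variable M : nat -> {mfun T >-> (int * int)%type}.
Hypothesis delta01 : 0 < delta < 1.
Hypothesis u01 : forall x, 0 < u x < 1.
Hypothesis hM_markov : markov_chain P M.
Hypothesis hM_init : P [set t | M 0%N t = origin] = 1%E.
Hypothesis hM_right : forall x y : int,
  transition_prob P M (x, y) (x + 1, y) (delta * u x).
Hypothesis hM_left : forall x y : int,
  transition_prob P M (x, y) (x - 1, y) (delta * (1 - u x)).
Hypothesis hM_vert : forall x y z : int,
  transition_prob P M (x, y) (x, y + z) ((1 - delta) * fine (nu [set z])).

(** [mscale] takes a number bundled with its non-negativity; the absolute values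
    provide it without the hypotheses on [delta] and [u]. *)
Definition step_law (s : int * int) : {measure set (int * int) -> \bar R} :=
  measure_add (mscale (`|delta * u s.1|%:nng) (dirac (s.1 + 1, s.2)))
 (measure_add (mscale (`|delta * (1 - u s.1)|%:nng) (dirac (s.1 - 1, s.2)))
              (mscale (`|1 - delta|%:nng) (distribution nu (vert s)))).

Let coef_ge0 x : [/\ 0 <= delta * u x, 0 <= delta * (1 - u x) & 0 <= 1 - delta].
Proof.
have /andP[d0 d1] := delta01; have /andP[u0 u1] := u01 x.
by split; rewrite ?subr_ge0 ?mulr_ge0 ?subr_ge0 ?ltW.
Qed.

Definition stepK (f : int * int -> \bar R) (s : int * int) : \bar R :=
  (\int[step_law s]_v f v)%E.

Lemma stepKE f s : (forall v, 0 <= f v)%E ->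
  stepK f s = ((delta * u s.1)%:E * f (s.1 + 1, s.2)%R +
   ((delta * (1 - u s.1))%:E * f (s.1 - 1, s.2)%R +
    (1 - delta)%:E * \int[nu]_z f (s.1, s.2 + z)%R))%E.
Proof.
move=> f0; have [a0 b0 c0] := coef_ge0 s.1.
have mf := measurable_fun_int2 f.
rewrite /stepK /step_law ge0_integral_measure_add//.
rewrite ge0_integral_measure_add//.
rewrite !ge0_integral_mscale//= !ger0_norm//.
rewrite !integral_dirac//= !diracT !mul1e.
by rewrite ge0_integral_pushforward.
Qed.

Lemma stepK_ge0 f s : (forall v, 0 <= f v)%E -> (0 <= stepK f s)%E.
Proof. by move=> f0; apply: integral_ge0. Qed.

Lemma le_stepK f g s : (forall v, 0 <= f v)%E -> (forall v, f v <= g v)%E ->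
  (stepK f s <= stepK g s)%E.
Proof.
move=> f0 fg; apply: ge0_le_integral => //; try exact: measurable_fun_int2.
Qed.

Lemma step_lawE s B : step_law s B =
  ((delta * u s.1)%:E * \d_(s.1 + 1, s.2)%R B +
  ((delta * (1 - u s.1))%:E * \d_(s.1 - 1, s.2)%R B +
    (1 - delta)%:E * nu (vert s @^-1` B)))%E.
Proof.
have [a0 b0 c0] := coef_ge0 s.1.
rewrite -(ger0_norm a0) -(ger0_norm b0) -(ger0_norm c0).
by rewrite /step_law/= /msum 2!big_ord_recl/= big_ord0 adde0 /msum 2!big_ord_recl/= big_ord0 adde0.
Qed.

Lemma step_lawT s : step_law s setT = 1%E.
Proof.
have [a0 b0 c0] := coef_ge0 s.1.
rewrite step_lawE !diracT preimage_setT probability_setT !mule1 -!EFinD.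
by congr (_%:E); ring.
Qed.

Lemma stepK_cst (c : \bar R) s : (0 <= c)%E -> stepK (cst c) s = c.
Proof.
by move=> c0; rewrite /stepK integral_cst// step_lawT mule1.
Qed.

Definition history (n : nat) (t : T) : seq (int * int) := mkseq (M ^~ t) n.+1.

Definition past (n : nat) (s : nat -> int * int) : set T :=
  [set t | forall k, (k <= n)%N -> M k t = s k].

Lemma measurable_visit n s : measurable [set t | M n t = s].
Proof.
rewrite -[X in measurable X]setTI.
exact: (measurable_funP (M n)) (measurable_int2 [set s]).
Qed.

Lemma measurable_past n s : measurable (past n s).
Proof.
rewrite (_ : past n s = \bigcap_(k in [set k | (k <= n)%N]) [set t | M k t = s k]).
  by apply: bigcap_measurable => [|k _]; [exists 0%N|exact: measurable_visit].
by apply/seteqP; split => t h k; exact: h.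
Qed.

Lemma history_past n h :
  [set t | history n t = h] = set0 \/
  [set t | history n t = h] = past n (nth origin h) /\ size h = n.+1.
Proof.
have [sz|sz] := eqVneq (size h) n.+1; last first.
  left; rewrite -subset0 => t /= ht; move: sz.
  by rewrite -ht size_mkseq eqxx.
right; split => //; apply/seteqP; split => t /= ht.
  by move=> k kn; rewrite -ht nth_mkseq.
apply: (@eq_from_nth _ origin); first by rewrite size_mkseq.
by move=> i; rewrite size_mkseq => ilt; rewrite nth_mkseq// ht.
Qed.

Lemma measurable_history n h : measurable [set t | history n t = h].
Proof.
by case: (history_past n h) => [->|[-> _]] //; exact: measurable_past.
Qed.

Lemma past_trans n (s : nat -> int * int) s' p :
  transition_prob P M (s n) s' p ->
  P ([set t | M n.+1 t = s'] `&` past n s) = (p%:E * P (past n s))%E.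
Proof.
move=> tr; have mp := measurable_past n s.
have [p0|p0] := eqVneq (P (past n s)) 0%E.
  rewrite p0 mule0; apply: (@subset_measure0 _ _ _ P _ (past n s)) => //.
  by apply: measurableI => //; exact: measurable_visit.
have {}p0 : (0 < P (past n s))%E by rewrite lt_neqAle eq_sym p0 measure_ge0.
pose s1 k := if (k <= n)%N then s k else s'.
have ps : past n s1 = past n s.
  by apply/seteqP; split=> t h k kn; have := h k kn; rewrite /s1 kn.
have := hM_markov (n := n) (s := s1); rewrite -/(past n s1) ps => /(_ p0).
rewrite /s1 ltnn leqnn tr; last first.
  rewrite (lt_le_trans p0)// le_measure ?inE//; first exact: measurable_visit.
  by move=> t /(_ n (leqnn n)).
rewrite /cond_prob => h.
rewrite -[in RHS](fineK (fin_num_measure P _ mp)) -EFinM -h divfK; last first.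
  by rewrite gt_eqF// fine_gt0// p0 (le_lt_trans (probability_le1 P mp)) ?ltry.
rewrite fineK// fin_num_measure//.
by apply: measurableI => //; exact: measurable_visit.
Qed.

(** The chain is only known to put the prescribed mass on the neighbours listed
    in the hypotheses. That it charges no other state will follow from the total
    mass, so it is enough that its law dominates [step_law] on points. *)
Lemma step_law1_cases (s s' : int * int) :
  (exists2 p, transition_prob P M s s' p & step_law s [set s'] = p%:E) \/
  step_law s [set s'] = 0%E.
Proof.
case: s s' => x y [x' y']; have [a0 b0 c0] := coef_ge0 x.
have E : step_law (x, y) [set (x', y')] =
   ((delta * u x)%:E * ((x + 1 == x') && (y == y'))%:R%:E +
   ((delta * (1 - u x))%:E * ((x - 1 == x') && (y == y'))%:R%:E +
   (1 - delta)%:E * (if x == x' then nu [set (y' - y)%R] else 0)))%E.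
  rewrite step_lawE !diracE !in_set1 !xpair_eqE; congr (_ + (_ + _ * _))%E.
  rewrite /vert/=; case: eqP => [->|ne].
    congr (nu _); apply/seteqP; split => z /=; first by move=> [<-]; ring.
    by move=> ->; congr pair; ring.
  by rewrite (_ : _ @^-1` _ = set0) ?measure0// -subset0 => z /= [].
have [xx'|nx] := eqVneq x x'.
  left; exists ((1 - delta) * fine (nu [set (y' - y)%R])).
    by have := @hM_vert x y (y' - y); rewrite subrKC xx'.
  rewrite E xx' eqxx -!xx' [in RHS]EFinM fineK ?fin_num_measure//.
  rewrite -[X in _ + 1 == X]addr0 -[X in _ - 1 == X]addr0 !(inj_eq (addrI x)).
  by rewrite !mule0 !add0e.
rewrite E (negbTE nx) mule0 adde0.
have [xp|np] := boolP ((x + 1 == x') && (y == y')).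
  left; exists (delta * u x).
    by case/andP: xp => /eqP <- /eqP <-; exact: hM_right.
  rewrite (_ : x - 1 == x' = false) /=; last by lia.
  by rewrite mule0 adde0 mule1.
have [xm|nm] := boolP ((x - 1 == x') && (y == y')).
  left; exists (delta * (1 - u x)).
    by case/andP: xm => /eqP <- /eqP <-; exact: hM_left.
  by rewrite mule0 add0e mule1.
by right; rewrite !mule0 add0e.
Qed.

(** Two finite measures are compared: the law of the next state on a given
    history, and the corresponding multiple of [step_law]. They have the same
    total mass, and the first dominates the second on points. *)
Lemma history_step n h (f : int * int -> \bar R) : (forall v, 0 <= f v)%E ->
  (\int[P]_(t in [set t | history n t = h]) f (M n.+1 t) =
   P [set t | history n t = h] * stepK f (last origin h))%E.
Proof.
move=> f0; case: (history_past n h) => [->|[hE sz]].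
  by rewrite integral_set0 measure0 mul0e.
set D := [set t | _]; have mD : measurable D by exact: measurable_history.
have mfM : measurable_fun setT (f \o M n.+1).
  by apply: measurableT_comp; [exact: measurable_fun_int2|exact: measurable_funP].
rewrite -(integral_mrestr P mD)//.
have finD : P D \is a fin_num by exact: fin_num_measure.
have PD0 : (0 <= fine (P D))%R by rewrite fine_ge0.
pose v := last origin h.
pose m0 : {measure set (int * int) -> \bar R} :=
  @pushforward _ _ T (int * int)%type R (mrestr P mD) (M n.+1).
pose m1 := m0 (measurable_funPT (M n.+1)).
pose m2 : {measure set (int * int) -> \bar R} := mscale (NngNum PD0) (step_law v).
have m1E C : m1 C = P (M n.+1 @^-1` C `&` D) by [].
have m2E C : m2 C = (P D * step_law v C)%E.
  by rewrite -[LHS]/((fine (P D))%:E * _)%E fineK.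
transitivity (\int[m1]_v f v)%E.
  by rewrite ge0_integral_pushforward//; exact: measurable_fun_int2.
transitivity (\int[m2]_v f v)%E; last first.
  by rewrite ge0_integral_mscale//= ?fineK//; exact: measurable_fun_int2.
apply: eq_measure_integral => B _ _.
have hn : nth origin h n = v by rewrite /v -nth_last sz.
apply: (@eq_measure_on_points _ _ _ _ _ (int * int)%type id) => //.
- exact: measurable_int2.
- move=> s; rewrite m1E m2E /D hE.
  have [[p tr ->]|->] := step_law1_cases v s; last by rewrite mule0.
  by rewrite -hn in tr; rewrite (past_trans tr) muleC.
- by rewrite m1E m2E step_lawT mule1 preimage_setT setTI.
- rewrite m1E preimage_setT setTI.
  by rewrite (le_lt_trans (probability_le1 P mD))// ltry.
Qed.

(** The Markov hypothesis concerns events that fix the whole past, so both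
    integrals are split along the countably many histories. *)
Lemma markov_step n (g : seq (int * int) -> \bar R) (f : int * int -> \bar R) :
  (forall h, 0 <= g h)%E -> (forall v, 0 <= f v)%E ->
  (\int[P]_t (g (history n t) * f (M n.+1 t)) =
   \int[P]_t (g (history n t) * stepK f (M n t)))%E.
Proof.
move=> g0 f0.
have mg : measurable_fun setT (g \o history n).
  move=> _ B mB; rewrite setTI -[_ @^-1` B]setTI -(bigcup_atom (history n)) setI_bigcupl.
  apply: bigcup_measurable => i _; case: (atomP (history n) i) => [->|[h ->]].
    by rewrite set0I.
  have [gh|gh] := pselect (B (g h)).
    rewrite (_ : _ `&` _ = [set t | history n t = h]); first exact: measurable_history.
    by apply/seteqP; split => [t []//|t /= ht]; split => //=; rewrite ht.
  rewrite (_ : _ `&` _ = set0)// -subset0 => t /= [ht]; rewrite ht //.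
have mM k (F : int * int -> \bar R) : measurable_fun setT (F \o M k).
  by apply: measurableT_comp; [exact: measurable_fun_int2|exact: measurable_funP].
have sK := fun s => stepK_ge0 s f0.
rewrite (integral_atoms P (H := history n)); last 3 first.
- exact: measurable_history.
- by apply: emeasurable_funM => //; exact: mM.
- by move=> t; rewrite mule_ge0.
rewrite [RHS](integral_atoms P (H := history n)); last 3 first.
- exact: measurable_history.
- by apply: emeasurable_funM => //; exact: (mM n (stepK f)).
- by move=> t; rewrite mule_ge0.
apply: eq_eseriesr => i _; case: (atomP (history n) i) => [->|[h ->]].
  by rewrite !integral_set0.
have mh := measurable_history n h.
under eq_integral => t /[!inE] /= -> do [].
under [RHS]eq_integral => t /[!inE] /= ht.
  rewrite ht (_ : M n t = last origin h); last first.
    by rewrite -ht /history -nth_last size_mkseq nth_mkseq.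
  over.
rewrite ge0_integralZl//; last exact: measurable_funTS (mM _ f).
by rewrite history_step// integral_cst//= muleAC muleA.
Qed.

(** * Green function and recurrence *)

Definition visit (n : nat) (s : int * int) : \bar R := P [set t | M n t = s].

Definition green (N : nat) : \bar R := (\sum_(n < N) visit n origin)%E.

Lemma measurable_fun_chain n (F : int * int -> \bar R) :
  measurable_fun setT (fun t => F (M n t)).
Proof.
apply: (@measurableT_comp _ _ _ _ _ _ F); first exact: measurable_fun_int2.
exact: measurable_funP.
Qed.

Lemma one_step n f : (forall v, 0 <= f v)%E ->
  (\int[P]_t f (M n.+1 t) = \int[P]_t stepK f (M n t))%E.
Proof.
move=> f0; have := @markov_step n (cst 1%E) f (fun=> @lee01 R) f0.
by rewrite /=; under eq_integral do rewrite mul1e;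
   under [X in _ = X -> _]eq_integral do rewrite mul1e.
Qed.

Lemma last_history n t : last origin (history n t) = M n t.
Proof. by rewrite /history -nth_last size_mkseq nth_mkseq. Qed.

Lemma take_history n t : take n.+1 (history n.+1 t) = history n t.
Proof. by rewrite /history /mkseq -map_take take_iota; congr map; congr iota; lia. Qed.

Definition avoid n J t := all (fun j => M (n + j).+1 t != origin) (iota 0 J).

Lemma avoidS n J t : avoid n J.+1 t = (M n.+1 t != origin) && avoid n.+1 J t.
Proof.
rewrite /avoid/= addn0; congr (_ && _).
rewrite (iotaDl 1 0) all_map; apply: eq_all => j /=.
by rewrite addnA addn1.
Qed.

(** Probability of avoiding the origin at times 1, ..., [J] from [s], computed
    from the kernel so that it does not refer to the chain. *)
Fixpoint escape (J : nat) (s : int * int) : \bar R :=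
  if J is J'.+1 then stepK (fun v => (v != origin)%:R%:E * escape J' v)%E s
  else 1%E.

Lemma escape_ge0 J s : (0 <= escape J s)%E.
Proof.
elim: J s => [|J IH] s //=; apply: stepK_ge0 => v.
by rewrite mule_ge0// lee_fin.
Qed.

Lemma measurable_avoid n J : measurable [set t | avoid n J t].
Proof.
elim: J n => [|J IH] n.
  by rewrite (_ : [set t | _] = setT)//; apply/seteqP; split.
rewrite (_ : [set t | _] =
  ~` [set t | M n.+1 t = origin] `&` [set t | avoid n.+1 J t]).
  by apply: measurableI => //; apply: measurableC; exact: measurable_visit.
apply/seteqP; split => t /=; rewrite avoidS.
  by move=> /andP[/eqP].
by move=> [/eqP -> ->].
Qed.

Lemma measurable_funb (A : set T) (b : T -> bool) : A = [set t | b t] ->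
  measurable A -> measurable_fun setT (fun t => (b t)%:R%:E : \bar R).
Proof.
move=> -> mb; apply/measurable_EFinP.
rewrite (_ : (fun _ => _) = \1_[set t | b t] :> (T -> R)); last first.
  apply/funext => t; rewrite indicE; case: (boolP (b t)) => h; first by rewrite mem_set.
  by rewrite memNset//; exact/negP.
exact: measurable_indic.
Qed.

Lemma avoid_escape J n (g : seq (int * int) -> \bar R) : (forall h, 0 <= g h)%E ->
  (\int[P]_t (g (history n t) * (avoid n J t)%:R%:E) =
   \int[P]_t (g (history n t) * escape J (M n t)))%E.
Proof.
elim: J n g => [|J IH] n g g0.
  by apply: eq_integral => t _.
pose g' h := (g (take n.+1 h) * (last origin h != origin)%:R%:E)%E.
have g'0 h : (0 <= g' h)%E by rewrite mule_ge0// lee_fin.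
transitivity (\int[P]_t (g' (history n.+1 t) * (avoid n.+1 J t)%:R%:E))%E.
  apply: eq_integral => t _; rewrite /g' take_history last_history avoidS.
  by rewrite -muleA; congr (_ * _)%E; case: eqP => _ /=; rewrite ?mul0e ?mul1e.
rewrite IH//.
transitivity (\int[P]_t (g (history n t) *
   (fun v => (v != origin)%:R%:E * escape J v) (M n.+1 t)))%E.
  by apply: eq_integral => t _; rewrite /g' take_history last_history -muleA.
rewrite (@markov_step n g (fun v => (v != origin)%:R%:E * escape J v)%E) => [//|//|v];
  by rewrite mule_ge0 ?lee_fin//; exact: escape_ge0.
Qed.

Lemma integral_bool (b : T -> bool) : measurable [set t | b t] ->
  (\int[P]_t (b t)%:R%:E = P [set t | b t])%E.
Proof.
move=> mb; rewrite -(setIT [set t | b t]) -integral_indic//.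
apply: eq_integral => t _; rewrite indicE; case: (boolP (b t)) => h.
  by rewrite mem_set.
by rewrite memNset//; exact/negP.
Qed.

Definition at_origin (v : int * int) : \bar R := (v == origin)%:R%:E.

Lemma visit_escape J n :
  P [set t | (M n t == origin) && avoid n J t] =
  (visit n origin * escape J origin)%E.
Proof.
have mA : measurable [set t | (M n t == origin) && avoid n J t].
  have := measurableI _ _ (measurable_visit n origin) (measurable_avoid n J).
  congr measurable; apply/seteqP; split => t /=; first by move=> [-> ->]; rewrite eqxx.
  by move=> /andP[/eqP].
rewrite -integral_bool//.
transitivity (\int[P]_t ((fun h => at_origin (last origin h)) (history n t)
    * (avoid n J t)%:R%:E))%E.
  apply: eq_integral => t _; rewrite last_history /at_origin.
  by case: eqP => _ /=; rewrite ?mul1e ?mul0e.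
rewrite (@avoid_escape J n (fun h => at_origin (last origin h))); last first.
  by move=> h; rewrite lee_fin.
have e0 := escape_ge0 J origin.
transitivity (\int[P]_t ((M n t == origin)%:R%:E * escape J origin))%E.
  apply: eq_integral => t _; rewrite last_history /at_origin.
  by case: eqP => [->//|_]; rewrite !mul0e.
have mv : measurable [set t | M n t == origin].
  by have := measurable_visit n origin; congr measurable; apply/seteqP; split => t /= /eqP.
rewrite ge0_integralZr//; last exact: (measurable_funb erefl).
by rewrite integral_bool//; congr (P _ * _)%E; apply/seteqP; split => t /= /eqP.
Qed.

(** The events that time [n] is a visit followed by [N] steps away from the
    origin are pairwise disjoint for [n < N]. *)
Lemma green_escape N : (green N * escape N origin <= 1)%E.
Proof.
rewrite /green ge0_sume_distrl; last by move=> n _; exact: measure_ge0.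
pose F n := if (n < N)%N then [set t | (M n t == origin) && avoid n N t] else set0.
have mF n : measurable (F n).
  rewrite /F; case: ifP => // _.
  have := measurableI _ _ (measurable_visit n origin) (measurable_avoid n N).
  congr measurable; apply/seteqP; split => t /=; first by move=> [-> ->]; rewrite eqxx.
  by move=> /andP[/eqP].
have key n m t : (n < m)%N -> F n t -> F m t -> False.
  rewrite /F; case: ifP => // nN; case: ifP => // mN nm /= /andP[_ /allP av] /andP[m0 _].
  have := av (m - n.+1)%N; rewrite mem_iota -addSn subnKC//.
  by rewrite (eqP m0) eqxx => h; have /h : (0 <= m - n.+1 < 0 + N)%N by lia.
have tF : trivIset setT F.
  move=> i j _ _ [t [Fi Fj]]; case: (ltngtP i j) => [ij|ij|//].
    by case: (key _ _ _ ij Fi Fj).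
  by case: (key _ _ _ ij Fj Fi).
rewrite (eq_bigr (fun i : 'I_N => P (F i))); last first.
  by move=> i _; rewrite /F ltn_ord visit_escape.
rewrite -measure_semi_additive_ord//; last 2 first.
- by move=> i j _ _ h; apply/val_inj/tF.
- exact: bigsetU_measurable.
by apply: probability_le1; exact: bigsetU_measurable.
Qed.

(** The escape probability is at most [(green N)^-1] for every [N], so each
    visit has probability zero of being the last one. *)
Lemma green_unbounded_recurrent :
  (forall C : R, exists N, (C%:E <= green N)%E) -> recurrent_at P M origin.
Proof.
move=> G.
pose D n := [set t | M n t = origin /\ forall m, (n < m)%N -> M m t != origin].
have mD n : measurable (D n).
  rewrite (_ : D n = [set t | M n t = origin] `&` \bigcap_m [set t | avoid n m t]).
    apply: measurableI; first exact: measurable_visit.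
    by apply: bigcapT_measurable => m; exact: measurable_avoid.
  apply/seteqP; split => t /=.
    by move=> [Mn h]; split => // m _ /=; apply/allP => j _; apply: h; lia.
  move=> [Mn h]; split => // m nm.
  have /allP/(_ (m - n.+1)%N) := h (m - n)%N I.
  by rewrite mem_iota -addSn subnKC// => -> //; lia.
have D0 n : P (D n) = 0%E.
  apply/eqP; rewrite eq_le measure_ge0 andbT; apply/lee_addgt0Pr => e e0.
  rewrite add0e.
  have [N hN] := G e^-1.
  have [E0 G1] := (escape_ge0 N origin, green_escape N).
  have leE : (escape N origin <= e%:E)%E.
    have : (e^-1%:E * escape N origin <= 1)%E.
      by apply: le_trans G1; exact: lee_wpmul2r.
    case: (escape N origin) E0 => [r|//|//]; last first.
      by rewrite gt0_muley// lte_fin invr_gt0.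
    by rewrite -EFinM !lee_fin mulrC ler_pdivrMr// mul1r.
  have mE : measurable [set t | (M n t == origin) && avoid n N t].
    have := measurableI _ _ (measurable_visit n origin) (measurable_avoid n N).
    congr measurable; apply/seteqP; split => t /=; first by move=> [-> ->]; rewrite eqxx.
    by move=> /andP[/eqP].
  apply: (@le_trans _ _ (P [set t | (M n t == origin) && avoid n N t])).
    apply: le_measure; rewrite ?inE// => t [Mn h] /=; rewrite Mn eqxx/=.
    by apply/allP => j _; apply: h; lia.
  rewrite visit_escape (le_trans _ leE)// -[leRHS]mul1e lee_wpmul2r//.
  by apply: probability_le1; exact: measurable_visit.
have neg0 : P.-negligible (~` [set t | M 0%N t = origin]).
  exists (~` [set t | M 0%N t = origin]); split => //.
    by apply: measurableC; exact: measurable_visit.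
  rewrite probability_setC ?hM_init ?subee//; exact: measurable_visit.
have negD : P.-negligible (\bigcup_n D n).
  apply: (@negligible_bigcup _ _ _ P D) => n.
  by exists (D n); split => //; exact: D0.
apply: negligibleS (negligibleU neg0 negD) => t /= nrec.
have [M0|] := pselect (M 0%N t = origin); last by left.
right; apply: contrapT => nD; apply: nrec => N.
elim: N => [|N [n Nn Mn]]; first by exists 0%N.
have : ~ D n t by move=> Dn; apply: nD; exists n.
move=> /not_andP[//|/existsNP[m /not_implyP[nm /negP/negPn/eqP Mm]]].
by exists m => //; exact: leq_ltn_trans nm.
Qed.

(** * Recursions for the occupation of sites and columns *)

Lemma measurable_fun_int3 d1 (U : measurableType d1) (f : (int * int) * int -> U) :
  measurable_fun setT f.
Proof.
move=> _ B _; apply: countable_measurable; last exact: countableP.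
case=> v z; rewrite (_ : [set _] = [set v] `*` [set z]).
  by apply: measurableX => //; exact: measurable_int2.
by apply/seteqP; split => [_ ->|[a b] [/= -> ->]].
Qed.

Lemma integral_vert n (f : int * int -> \bar R) : (forall v, 0 <= f v)%E ->
  (\int[P]_t \int[nu]_z f (vert (M n t) z) =
   \int[nu]_z \int[P]_t f (vert (M n t) z))%E.
Proof.
move=> f0.
pose F (p : T * int) := f (vert (M n p.1) p.2).
apply: (fubini_tonelli F); last by move=> p; exact: f0.
rewrite (_ : F = (fun q : (int * int) * int => f (vert q.1 q.2)) \o
   (fun p => (M n p.1, p.2)))//.
apply: measurableT_comp; first exact: measurable_fun_int3.
apply: measurable_fun_pair => //.
by apply: measurableT_comp; [exact: measurable_funP|exact: measurable_fst].
Qed.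

Lemma measurable_event n (b : int * int -> bool) : measurable [set t | b (M n t)].
Proof.
rewrite -[X in measurable X]setTI.
exact: (measurable_funP (M n)) (measurable_int2 [set v | b v]).
Qed.

Lemma integral_event n (b : int * int -> bool) :
  (\int[P]_t (b (M n t))%:R%:E = P [set t | b (M n t)])%E.
Proof. exact: integral_bool (measurable_event n b). Qed.

Lemma visitE n s : visit n s = P [set t | M n t == s].
Proof. by rewrite /visit; congr (P _); apply/seteqP; split => t /eqP. Qed.

Lemma one_step_event n (b : int * int -> bool) :
  P [set t | b (M n.+1 t)] =
  (\int[P]_t ((delta * u (M n t).1)%:E * (b ((M n t).1 + 1, (M n t).2)%R)%:R%:E) +
  (\int[P]_t ((delta * (1 - u (M n t).1))%:E * (b ((M n t).1 - 1, (M n t).2)%R)%:R%:E) +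
   (1 - delta)%:E * \int[nu]_z P [set t | b (vert (M n t) z)]))%E.
Proof.
rewrite -integral_event (one_step n (f := fun v => (b v)%:R%:E)); last first.
  by move=> v; rewrite lee_fin.
have E v : stepK (fun v => (b v)%:R%:E) v =
  ((delta * u v.1)%:E * (b (v.1 + 1, v.2)%R)%:R%:E +
  ((delta * (1 - u v.1))%:E * (b (v.1 - 1, v.2)%R)%:R%:E +
   (1 - delta)%:E * \int[nu]_z (b (vert v z))%:R%:E))%E.
  by rewrite stepKE// => w; rewrite lee_fin.
under eq_integral => t _ do rewrite E.
have i0 t : (0 <= \int[nu]_z (b (vert (M n t) z))%:R%:E)%E.
  by apply: integral_ge0 => z _; rewrite lee_fin.
have c0 x : [/\ 0 <= delta * u x, 0 <= delta * (1 - u x) & 0 <= 1 - delta].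
  exact: coef_ge0.
pose F1 v := ((delta * u v.1)%:E * (b (v.1 + 1, v.2)%R)%:R%:E)%E : \bar R.
pose F2 v := ((delta * (1 - u v.1))%:E * (b (v.1 - 1, v.2)%R)%:R%:E)%E : \bar R.
pose F3 v := ((1 - delta)%:E * \int[nu]_z (b (vert v z))%:R%:E)%E.
have F10 v : (0 <= F1 v)%E by case: (c0 v.1) => *; rewrite mule_ge0 ?lee_fin.
have F20 v : (0 <= F2 v)%E by case: (c0 v.1) => *; rewrite mule_ge0 ?lee_fin.
have F30 v : (0 <= F3 v)%E.
  case: (c0 v.1) => *; rewrite mule_ge0 ?lee_fin//.
  by apply: integral_ge0 => z _; rewrite lee_fin.
rewrite (@ge0_integralD _ _ _ P setT measurableT (fun t => F1 (M n t))
  (fun t => F2 (M n t) + F3 (M n t))%E) => //; last 3 first.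
- exact: measurable_fun_chain.
- by move=> t _; exact: adde_ge0.
- by apply: emeasurable_funD; exact: measurable_fun_chain.
congr (_ + _)%E.
rewrite (@ge0_integralD _ _ _ P setT measurableT (fun t => F2 (M n t))
  (fun t => F3 (M n t))) => //; last 2 first.
- exact: measurable_fun_chain.
- exact: measurable_fun_chain.
congr (_ + _)%E.
rewrite ge0_integralZl//; last 2 first.
- exact: (measurable_fun_chain n (fun v => \int[nu]_z (b (vert v z))%:R%:E)%E).
- by case: (c0 0) => _ _; rewrite lee_fin.
rewrite (@integral_vert n (fun v => (b v)%:R%:E)); last by move=> v; rewrite lee_fin.
congr (_ * _)%E; apply: eq_integral => z _.
by rewrite (integral_event n (fun v => b (vert v z))).
Qed.

Lemma integral_coef n (a : int -> R) (b : int * int -> bool) x :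
  (forall x, 0 <= a x) -> (forall v, b v -> v.1 = x) ->
  (\int[P]_t ((a (M n t).1)%:E * (b (M n t))%:R%:E) =
   (a x)%:E * P [set t | b (M n t)])%E.
Proof.
move=> a0 bx; rewrite -integral_event -ge0_integralZl//; last 2 first.
- exact: (measurable_fun_chain n (fun v => (b v)%:R%:E)).
- by rewrite lee_fin.
apply: eq_integral => t _; case: (boolP (b (M n t))) => [/bx ->//|_].
by rewrite !mule0.
Qed.

Lemma visitS n x y : visit n.+1 (x, y) =
  ((delta * u (x - 1))%:E * visit n (x - 1, y)%R +
  ((delta * (1 - u (x + 1)))%:E * visit n (x + 1, y)%R +
   (1 - delta)%:E * \int[nu]_z visit n (x, y - z)%R))%E.
Proof.
rewrite !visitE (one_step_event n (fun v => v == (x, y))); congr (_ + (_ + _ * _))%E.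
- rewrite (@integral_coef n (fun x => delta * u x)
    (fun v => (v.1 + 1, v.2) == (x, y)) (x - 1)); last 2 first.
    by move=> a; case: (coef_ge0 a).
    by move=> v; rewrite xpair_eqE => /andP[/eqP <- _]; rewrite addrK.
  congr (_ * P _)%E; apply/seteqP; split => t /=; rewrite !xpair_eqE.
    by move=> /andP[/eqP <- /eqP <-]; rewrite addrK -surjective_pairing eqxx.
  by move=> /eqP ->; rewrite subrK !eqxx.
- rewrite (@integral_coef n (fun x => delta * (1 - u x))
    (fun v => (v.1 - 1, v.2) == (x, y)) (x + 1)); last 2 first.
    by move=> a; case: (coef_ge0 a).
    by move=> v; rewrite xpair_eqE => /andP[/eqP <- _]; rewrite subrK.
  congr (_ * P _)%E; apply/seteqP; split => t /=; rewrite !xpair_eqE.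
    by move=> /andP[/eqP <- /eqP <-]; rewrite subrK -surjective_pairing eqxx.
  by move=> /eqP ->; rewrite addrK !eqxx.
- apply: eq_integral => z _; rewrite visitE; congr (P _).
  apply/seteqP; split => t /=; rewrite /vert.
    move=> /eqP [<- <-]; rewrite addrK; apply/eqP; exact: surjective_pairing.
  by move=> /eqP ->; rewrite /= subrK.
Qed.

Definition column n x : \bar R := P [set t | (M n t).1 == x].

Lemma columnS n x : column n.+1 x =
  ((delta * u (x - 1))%:E * column n (x - 1)%R +
  ((delta * (1 - u (x + 1)))%:E * column n (x + 1)%R +
   (1 - delta)%:E * column n x))%E.
Proof.
rewrite /column (one_step_event n (fun v => v.1 == x)); congr (_ + (_ + _ * _))%E.
- rewrite (@integral_coef n (fun x => delta * u x) (fun v => v.1 + 1 == x) (x - 1)).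
  + by congr (_ * P _)%E; apply/seteqP; split => t /=; rewrite (can2_eq (addrK 1) (subrK 1)).
  + by move=> a; case: (coef_ge0 a).
  + by move=> v /eqP <-; rewrite addrK.
- rewrite (@integral_coef n (fun x => delta * (1 - u x)) (fun v => v.1 - 1 == x) (x + 1)).
  + by congr (_ * P _)%E; apply/seteqP; split => t /=; rewrite subr_eq.
  + by move=> a; case: (coef_ge0 a).
  + by move=> v /eqP <-; rewrite subrK.
- by rewrite /vert/= integral_probability_cst.
Qed.

Lemma not_start : P (~` [set t | M 0%N t = origin]) = 0%E.
Proof.
by rewrite probability_setC ?hM_init ?subee//; exact: measurable_visit.
Qed.

Lemma start_event (b : int * int -> bool) : ~~ b origin ->
  P [set t | b (M 0%N t)] = 0%E.
Proof.
move=> nb; apply/eqP; rewrite eq_le measure_ge0 andbT -not_start.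
apply: le_measure; rewrite ?inE; [exact: measurable_event| |].
  by apply: measurableC; exact: measurable_visit.
by move=> t /= bt M0; move: nb; rewrite -M0 bt.
Qed.

(** * Comparison with a reversible measure *)

Section reversible.
Variable pi : int -> R.
Hypothesis pi_gt0 : forall x, 0 < pi x.
Hypothesis balance : forall x, pi x * u x = pi (x + 1) * (1 - u (x + 1)).

Lemma pi_invariant x : delta * u (x - 1) * pi (x - 1) +
  (delta * (1 - u (x + 1)) * pi (x + 1) + (1 - delta) * pi x) = pi x.
Proof.
have := balance x; have := balance (x - 1); rewrite subrK => h1 h2.
rewrite -!mulrA [u _ * _]mulrC [(1 - u _) * _]mulrC h1 -h2; ring.
Qed.

Lemma visit_fin n s : visit n s \is a fin_num.
Proof. by apply: fin_num_measure; exact: measurable_visit. Qed.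

Lemma visit0 s : s != origin -> visit 0 s = 0%E.
Proof.
by move=> so; rewrite visitE (start_event (b := fun v => v == s))// eq_sym.
Qed.

Definition visits N s : \bar R := (\sum_(n < N) visit n s)%E.

Lemma visits_ge0 N s : (0 <= visits N s)%E.
Proof. by apply: sume_ge0 => i _; exact: measure_ge0. Qed.

Lemma visitsS N x y : visits N.+1 (x, y) =
  (visit 0 (x, y) + ((delta * u (x - 1))%:E * visits N (x - 1, y)%R +
  ((delta * (1 - u (x + 1)))%:E * visits N (x + 1, y)%R +
   (1 - delta)%:E * \int[nu]_z visits N (x, y - z)%R)))%E.
Proof.
rewrite {1}/visits big_ord_recl/=; congr (_ + _)%E.
rewrite (eq_bigr _ (fun (i : 'I_N) _ => visitS i x y)) !big_split/=.
rewrite -!ge0_sume_distrr; try by move=> i _; exact: measure_ge0.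
  rewrite ge0_integral_sum//.
by move=> i _; apply: integral_ge0 => z _; exact: measure_ge0.
Qed.

(** Divided by [pi], the occupation measure evolves by the time-reversed
    kernel, which averages because [pi] is invariant; the only source is the
    starting point, so the maximum stays at the origin. The vertical integral
    is harmless since it averages over translates. *)
Lemma visits_le N s : (visits N s <= (pi s.1 / pi 0)%:E * green N)%E.
Proof.
elim: N s => [|N IH] [x y].
  by rewrite /visits /green !big_ord0 mule0.
have [->|so] := eqVneq (x, y) origin.
  by rewrite divff ?mul1e//= gt_eqF.
have [a0 b0 _] := coef_ge0 (x - 1); have [_ c0 d0] := coef_ge0 (x + 1).
rewrite visitsS visit0// add0e.
have gr : (green N <= green N.+1)%E.
  by rewrite /green big_ord_recr/= leeDl//; exact: measure_ge0.
have gf : green N \is a fin_num by apply/sum_fin_numP => i _ _; exact: visit_fin.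
have p0 z : 0 <= pi z / pi 0 by rewrite divr_ge0 ?ltW.
apply: le_trans (lee_wpmul2l _ gr); last by rewrite lee_fin p0.
have := IH; move: gf; case: (green N) => // g _ {}IH.
apply: (@le_trans _ _ ((delta * u (x - 1))%:E * ((pi (x - 1) / pi 0)%:E * g%:E) +
  ((delta * (1 - u (x + 1)))%:E * ((pi (x + 1) / pi 0)%:E * g%:E) +
   (1 - delta)%:E * ((pi x / pi 0)%:E * g%:E)))%E); last first.
  rewrite -!EFinM -!EFinD lee_fin le_eqVlt; apply/orP; left; apply/eqP.
  by rewrite -[in RHS](pi_invariant x); ring.
apply: leeD; first by apply: lee_wpmul2l; rewrite ?lee_fin//; exact: (IH (x - 1, y)).
apply: leeD; first by apply: lee_wpmul2l; rewrite ?lee_fin//; exact: (IH (x + 1, y)).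
apply: lee_wpmul2l; rewrite ?lee_fin//.
apply: (@le_trans _ _ (\int[nu]_z (cst ((pi x / pi 0)%:E * g%:E)%E z))%E).
  apply: ge0_le_integral => //; first by move=> z _; exact: visits_ge0.
by rewrite integral_probability_cst.
Qed.

(** The horizontal coordinate is itself a lazy reversible chain, and its law at
    time 0 is dominated by the invariant measure [pi / pi 0]. *)
Lemma column_le n x : (column n x <= (pi x / pi 0)%:E)%E.
Proof.
have p0 z : 0 <= pi z / pi 0 by rewrite divr_ge0 ?ltW.
elim: n x => [|n IH] x.
  have [->|x0] := eqVneq x 0.
    rewrite divff ?gt_eqF//; apply: probability_le1.
    exact: (measurable_event 0 (fun v => v.1 == 0)).
  by rewrite /column (start_event (b := fun v => v.1 == x)) ?lee_fin// eq_sym.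
have [a0 b0 _] := coef_ge0 (x - 1); have [_ c0 d0] := coef_ge0 (x + 1).
rewrite columnS.
apply: (@le_trans _ _ ((delta * u (x - 1))%:E * (pi (x - 1) / pi 0)%:E +
  ((delta * (1 - u (x + 1)))%:E * (pi (x + 1) / pi 0)%:E +
   (1 - delta)%:E * (pi x / pi 0)%:E))%E); last first.
  rewrite -!EFinM -!EFinD lee_fin le_eqVlt; apply/orP; left; apply/eqP.
  by rewrite -[in RHS](pi_invariant x); ring.
apply: leeD; first by apply: lee_wpmul2l; rewrite ?lee_fin//.
apply: leeD; first by apply: lee_wpmul2l; rewrite ?lee_fin//.
by apply: lee_wpmul2l; rewrite ?lee_fin//.
Qed.

(** The horizontal motion is nearest neighbour, so a chain that is beyond [c]
    has visited the column [c]; each of the [n] earlier times contributes at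
    most the stationary bound of [column_le]. The predicate [beyond] serves for
    both sides. *)
Lemma beyond_le (beyond : pred int) (c : int) n :
  (forall x, beyond (x + 1) || beyond (x - 1) || beyond x -> beyond x || (x == c)) ->
  ~~ beyond 0 ->
  (P [set t | beyond (M n t).1] <= (n%:R * (pi c / pi 0))%:E)%E.
Proof.
move=> step b0; elim: n => [|n IH].
  by rewrite mul0r (start_event (b := fun v => beyond v.1)).
rewrite -(integral_event n.+1 (fun v => beyond v.1)).
rewrite (one_step n (f := fun v => (beyond v.1)%:R%:E)); last first.
  by move=> v; rewrite lee_fin.
apply: (@le_trans _ _ (\int[P]_t ((beyond (M n t).1)%:R%:E + ((M n t).1 == c)%:R%:E))%E).
  apply: ge0_le_integral => //.
  - by move=> t _; apply: stepK_ge0 => v; rewrite lee_fin.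
  - exact: (measurable_fun_chain n (stepK _)).
  - exact: (measurable_fun_chain n (fun v => (beyond v.1)%:R%:E + (v.1 == c)%:R%:E)%E).
  move=> t _; have := step (M n t).1; case: (boolP (beyond (M n t).1 || _)) => /= [+ _|_ h].
    move=> bc; apply: (@le_trans _ _ 1%E).
      apply: (@le_trans _ _ (stepK (cst 1%E) (M n t))); last by rewrite stepK_cst.
      by apply: le_stepK => v; rewrite lee_fin// lern1 leq_b1.
    by rewrite -EFinD lee_fin; case/orP: bc => ->; rewrite ?lerDl ?lerDr ler0n.
  rewrite stepKE; last by move=> v; rewrite lee_fin.
  case: (beyond ((M n t).1 + 1)) h => /= [/(_ isT)//|].
  case: (beyond ((M n t).1 - 1)) => /= [/(_ isT)//|].
  case: (beyond (M n t).1) => /= [/(_ isT)//|].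
  by rewrite integral0 !mule0 !add0e lee_fin.
rewrite ge0_integralD//; last 2 first.
- exact: (measurable_fun_chain n (fun v => (beyond v.1)%:R%:E)%E).
- exact: (measurable_fun_chain n (fun v => (v.1 == c)%:R%:E)%E).
rewrite (integral_event n (fun v => beyond v.1)) (integral_event n (fun v => v.1 == c)).
rewrite -natr1 mulrDl mul1r EFinD; apply: leeD => //; exact: column_le.
Qed.

(** At every time before [N] the chain is in the box with probability at least
    1/4, its complement being covered by three events of probability at most
    1/4. Summing over time and bounding the occupation of each site by
    [visits_le] compares [N / 4] with the Green function at the origin. *)
Lemma green_lower (N b c m : nat) (Q : R) :
  (forall x : int, - b%:Z <= x <= c%:Z -> pi x <= Q) ->
  N%:R * (pi c%:Z / pi 0) <= 4^-1 ->
  N%:R * (pi (- b%:Z) / pi 0) <= 4^-1 ->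
  (forall n, (n < N)%N -> P [set t | (m < `|(M n t).2|)%N] <= 4^-1%:E)%E ->
  ((N%:R / 4)%:E <=
   ((b + c).+1%:R * m.*2.+1%:R * (Q / pi 0))%:E * green N)%E.
Proof.
move=> piQ hc hb hv.
pose pt i j : int * int := (i%:Z - b%:Z, j%:Z - m%:Z).
have box n : (n < N)%N ->
   (4^-1%:E <= \sum_(i < (b + c).+1) \sum_(j < m.*2.+1) visit n (pt i j))%E.
  move=> nN.
  pose R1 := [set t | (c%:Z < (M n t).1)%R].
  pose R2 := [set t | ((M n t).1 < - b%:Z)%R].
  pose R3 := [set t | (m < `|(M n t).2|)%N].
  pose R4 := \big[setU/set0]_(i < (b + c).+1) \big[setU/set0]_(j < m.*2.+1)
     [set t | M n t = pt i j].
  have m1 : measurable R1 by exact: (measurable_event n (fun v => (c%:Z < v.1)%R)).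
  have m2 : measurable R2 by exact: (measurable_event n (fun v => (v.1 < - b%:Z)%R)).
  have m3 : measurable R3 by exact: (measurable_event n (fun v => (m < `|v.2|)%N)).
  have m4i i : measurable (\big[setU/set0]_(j < m.*2.+1) [set t | M n t = pt i j]).
    by apply: bigsetU_measurable => j _; exact: measurable_visit.
  have m4 : measurable R4 by apply: bigsetU_measurable.
  have n0 : n%:R <= N%:R :> R by rewrite ler_nat ltnW.
  have q0 z : 0 <= pi z / pi 0 by rewrite divr_ge0 ?ltW.
  have h1 : (P R1 <= 4^-1%:E)%E.
    apply: le_trans (@beyond_le (fun x => c%:Z < x) c%:Z n _ _) _; [by lia|by lia|].
    by rewrite lee_fin (le_trans _ hc)// ler_wpM2r.
  have h2 : (P R2 <= 4^-1%:E)%E.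
    apply: le_trans (@beyond_le (fun x => x < - b%:Z) (- b%:Z) n _ _) _; [by lia|by lia|].
    by rewrite lee_fin (le_trans _ hb)// ler_wpM2r.
  have h3 : (P R3 <= 4^-1%:E)%E by exact: hv.
  have h4 : (P R4 <= \sum_(i < (b + c).+1) \sum_(j < m.*2.+1) visit n (pt i j))%E.
    apply: le_trans (Boole_inequality P (A := fun i =>
      \big[setU/set0]_(j < m.*2.+1) [set t | M n t = pt i j]) _) _ => //.
    apply: lee_sum => i _; apply: (Boole_inequality P (A := fun j => [set t | M n t = pt i j])).
    by move=> j _; exact: measurable_visit.
  have : (1 <= 4^-1%:E + (4^-1%:E + (4^-1%:E + P R4)))%E.
    rewrite -(probability_setT P).
    have -> : [set: T] = R1 `|` (R2 `|` (R3 `|` R4)).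
      apply/esym/seteqP; split => // t _.
      have [h|h] := boolP (c%:Z < (M n t).1)%R; first by left.
      have [h'|h'] := boolP ((M n t).1 < - b%:Z)%R; first by right; left.
      have [h''|h''] := boolP (m < `|(M n t).2|)%N; first by right; right; left.
      right; right; right; rewrite /R4 -(bigcup_mkord _ (fun i =>
        \big[setU/set0]_(j < m.*2.+1) [set t | M n t = pt i j])).
      case E : (M n t) h h' h'' => [x y] /= h h' h''.
      exists `|(x + b%:Z)%R|%N; first by rewrite /=; clear -h h' h''; lia.
      rewrite -(bigcup_mkord _ (fun j => [set t | M n t = pt _ j])).
      exists `|(y + m%:Z)%R|%N; first by rewrite /=; clear -h h' h''; lia.
      by rewrite /= /pt E; clear -h h' h''; congr pair; lia.
    apply: le_trans (measureU2 _ _ _) _ => //; first by do 2 apply: measurableU => //.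
    apply: leeD => //; apply: le_trans (measureU2 _ _ _) _ => //; first exact: measurableU.
    apply: leeD => //; apply: le_trans (measureU2 _ _ _) _ => //.
    exact: leeD.
  have f4 : P R4 \is a fin_num by exact: fin_num_measure.
  move: h4; rewrite -(fineK f4) => h4; rewrite -!EFinD lee_fin => h5.
  by apply: le_trans h4; rewrite lee_fin; lra.
apply: (@le_trans _ _ (\sum_(n < N) \sum_(i < (b + c).+1) \sum_(j < m.*2.+1) visit n (pt i j))%E).
  apply: (@le_trans _ _ (\sum_(n < N) 4^-1%:E)%E).
    by rewrite sumEFin sumr_const card_ord lee_fin -[leRHS]mulr_natl.
  by apply: lee_sum => n _; exact: box.
rewrite exchange_big/=; under eq_bigr do rewrite exchange_big/=.
have gf : green N \is a fin_num by apply/sum_fin_numP => i _ _; exact: visit_fin.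
have g0 : (0 <= green N)%E by apply: sume_ge0 => i _; exact: measure_ge0.
apply: (@le_trans _ _ (\sum_(i < (b + c).+1) \sum_(j < m.*2.+1) ((Q / pi 0)%:E * green N))%E).
  apply: lee_sum => i _; apply: lee_sum => j _.
  apply: le_trans (visits_le N (pt i j)) _; apply: lee_wpmul2r => //.
  rewrite lee_fin ler_wpM2r ?invr_ge0 ?(ltW (pi_gt0 0))//;
  by apply: piQ => /=; have := ltn_ord i; clear; lia.
move: gf; case: (green N) => // g _.
rewrite -EFinM !sumEFin !sumr_const !card_ord -EFinM lee_fin le_eqVlt; apply/orP; left.
by apply/eqP; rewrite -[LHS]mulr_natl -[X in _ * X]mulr_natl !mulrA.
Qed.

End reversible.

(** * The vertical displacement *)

(** The vertical coordinate at time [n] is a sum of at most [n] independent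
    steps of law [nu], in random number. If [W k] is the expectation of a
    function after [k] further steps, one step of the chain turns [W j] into
    the convex combination [delta W j + (1 - delta) W (j + 1)], so after [n]
    of them the expectation is at most the worst of [W j, ..., W (j + n)]. *)
Lemma vertical_le (W : nat -> int -> \bar R) (B : \bar R) n j :
  (forall k y, 0 <= W k y)%E -> (0 <= B)%E ->
  (forall k y, W k.+1 y = \int[nu]_z W k (y + z)%R)%E ->
  (forall k, (j <= k <= j + n)%N -> W k 0%R <= B)%E ->
  (\int[P]_t W j (M n t).2 <= B)%E.
Proof.
move=> W0 B0 WS; elim: n j => [|n IH] j hB.
  rewrite (ae_eq_integral (cst (W j 0))) //=; last 2 first.
  - exact: (measurable_fun_chain 0 (fun v => W j v.2)).
  - exists (~` [set t | M 0%N t = origin]); split.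
    + by apply: measurableC; exact: measurable_visit.
    + exact: not_start.
    + by move=> t /= h M0; apply: h => _; rewrite M0.
  by rewrite integral_probability_cst hB// leqnn leq_addr.
rewrite (one_step n (f := fun v => W j v.2)); last by move=> v.
have [_ _ d0] := coef_ge0 0; have /andP[d1 _] := delta01.
have E v : stepK (fun v => W j v.2) v =
    (delta%:E * W j v.2 + (1 - delta)%:E * W j.+1 v.2)%E.
  rewrite stepKE//= WS addeA -ge0_muleDl ?lee_fin; last 2 first.
  - by case: (coef_ge0 v.1).
  - by case: (coef_ge0 v.1).
  by congr (_ * _ + _)%E; rewrite -EFinD; congr (_%:E); ring.
under eq_integral => t _ do rewrite E.
rewrite ge0_integralD//=; last 4 first.
- by move=> t _; rewrite mule_ge0// lee_fin ltW.
- exact: (measurable_fun_chain n (fun v => delta%:E * W j v.2)%E).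
- by move=> t _; rewrite mule_ge0// lee_fin ltW.
- exact: (measurable_fun_chain n (fun v => (1 - delta)%:E * W j.+1 v.2)%E).
rewrite !ge0_integralZl//; try by rewrite lee_fin ltW.
2,3: exact: (measurable_fun_chain n (fun v => W _ v.2)).
have -> : B = (delta%:E * B + (1 - delta)%:E * B)%E.
  rewrite -ge0_muleDl ?lee_fin//; last exact: ltW.
  by rewrite -EFinD subrKC mul1e.
apply: leeD; apply: lee_wpmul2l; rewrite ?lee_fin//; first exact: ltW.
  by apply: IH => k hk; apply: hB; lia.
by apply: IH => k hk; apply: hB; lia.
Qed.

End chain.

(** * Expectations of bounded functions *)

Section bounded_expectation.
Context {R : realType}.

Lemma probability_measure_setT d (T : measurableType d) (P : probability T R) :
  (P : {measure set T -> \bar R}) setT = 1%E.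
Proof. exact: probability_setT. Qed.

Lemma bounded_integrable d (T : measurableType d) (P : probability T R)
    (f : T -> R) (C : R) : measurable_fun setT f -> (forall x, `|f x| <= C) ->
  P.-integrable setT (EFin \o f).
Proof.
move=> mf fC; apply: measurable_bounded_integrable => //.
  by rewrite probability_measure_setT ltry.
exists C; split; first exact: num_real.
by move=> M CM x _ /=; apply: (le_trans (fC x)); exact: ltW.
Qed.

Lemma bound_ge0 d (T : measurableType d) (P : probability T R) (f : T -> R) (C : R) :
  (forall x, `|f x| <= C) -> 0 <= C.
Proof.
move=> fC; have [x _] : exists x : T, setT x; last exact: le_trans (fC x).
apply: contrapT => nex; have : P setT = 0%E.
  rewrite (_ : setT = set0) ?measure0// -subset0 => x _; apply: nex; by exists x.
by rewrite probability_setT => /eqP; rewrite eqe oner_eq0.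
Qed.

Lemma Rintegral_probability_cst d (T : measurableType d) (P : probability T R)
  (c : R) : \int[P]_x c = c.
Proof. by rewrite Rintegral_cst// probability_measure_setT mulr1. Qed.

Lemma norm_Rintegral_le d (T : measurableType d) (P : probability T R)
    (f : T -> R) (C : R) : measurable_fun setT f -> (forall x, `|f x| <= C) ->
  `|\int[P]_x f x| <= C.
Proof.
move=> mf fC; apply: le_trans (le_normr_Rintegral measurableT _) _.
  exact: (bounded_integrable P mf fC).
rewrite -[leRHS](Rintegral_probability_cst P); apply: le_Rintegral => //.
- by apply: (@bounded_integrable _ _ _ _ C);
    [exact: measurableT_comp|move=> x; rewrite normr_id].
- by apply: (@bounded_integrable _ _ _ _ `|C|).
Qed.

Lemma Rintegral_distribution d (T : measurableType d) d' (U : measurableType d')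
    (P : probability T R) (X : {RV P >-> U}) (f : U -> R) (C : R) :
  measurable_fun setT f -> (forall x, `|f x| <= C) ->
  \int[distribution P X]_y f y = \int[P]_x f (X x).
Proof.
move=> mf fC; rewrite /Rintegral (integral_distribution (f := EFin \o f))//.
  exact/measurable_EFinP.
apply: (@bounded_integrable _ _ P _ C) => //.
by apply: measurableT_comp => //; exact: measurable_funP.
Qed.

Lemma Rintegral_prod d1 d2 (T1 : measurableType d1) (T2 : measurableType d2)
    (P1 : probability T1 R) (P2 : probability T2 R) (f : T1 -> R) (g : T2 -> R)
    (C : R) :
  measurable_fun setT f -> measurable_fun setT g ->
  (forall x, `|f x| <= C) -> (forall x, `|g x| <= C) ->
  \int[(P1 \x P2)%E]_z (f z.1 * g z.2) = (\int[P1]_x f x) * (\int[P2]_y g y).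
Proof.
move=> mf mg fC gC; have C0 := bound_ge0 P1 fC.
have mfg : measurable_fun setT (fun z : T1 * T2 => f z.1 * g z.2).
  by apply: measurable_funM; apply: measurableT_comp => //.
have ifg : (P1 \x P2)%E.-integrable setT (fun z => (f z.1 * g z.2)%:E).
  apply: (@bounded_integrable _ _ (P1 \x P2)%E _ (C * C)) => // z.
  by rewrite normrM ler_pM.
rewrite /Rintegral -(integral12_prod_meas1 ifg).
have E x : fubini_F P2 (fun z => (f z.1 * g z.2)%:E) x = (\int[P2]_y g y * f x)%:E.
  rewrite /fubini_F /= mulrC -RintegralZl//; last exact: (bounded_integrable P2 mg gC).
  rewrite /Rintegral fineK//; apply: integrable_fin_num => //.
  apply: (@bounded_integrable _ _ _ _ (C * C)); first exact: measurable_funM.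
  by move=> y; rewrite normrM ler_pM.
transitivity (\int[P1]_x (\int[P2]_y g y * f x)).
  by congr fine; apply: eq_integral => x _; exact: E.
rewrite RintegralZl//; last first.
  exact: (bounded_integrable P1 mf fC).
by rewrite mulrC.
Qed.

End bounded_expectation.

(** * Squared modulus of characteristic functions *)

Section characteristic.
Context {R : realType}.
Implicit Types (m : probability R R) (t : R).

Definition ecos m t : R := \int[m]_x cos (t * x).
Definition esin m t : R := \int[m]_x sin (t * x).
(** The squared modulus of the characteristic function is insensitive to
    translations, hence to the centering constants of stability, and stays
    real. *)
Definition char2 m t : R := ecos m t ^+ 2 + esin m t ^+ 2.

Lemma measurable_cosM t : measurable_fun setT (fun x : R => cos (t * x)).
Proof.
apply: measurableT_comp; last exact: measurable_funM.
by apply: continuous_measurable_fun; exact: continuous_cos.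
Qed.

Lemma measurable_sinM t : measurable_fun setT (fun x : R => sin (t * x)).
Proof.
apply: measurableT_comp; last exact: measurable_funM.
by apply: continuous_measurable_fun; exact: continuous_sin.
Qed.

Let mc := measurable_cosM.
Let ms := measurable_sinM.
Let ic m t : m.-integrable setT (fun x => (cos (t * x))%:E).
Proof. exact: (bounded_integrable m (mc t) (fun x => cos_max _)). Qed.
Let isn m t : m.-integrable setT (fun x => (sin (t * x))%:E).
Proof. exact: (bounded_integrable m (ms t) (fun x => sin_max _)). Qed.

Let ecosZ m t r : \int[m]_x (r * cos (t * x)) = r * ecos m t.
Proof. exact: (@RintegralZl _ _ _ m setT _ r measurableT (ic m t)). Qed.
Let esinZ m t r : \int[m]_x (r * sin (t * x)) = r * esin m t.
Proof. exact: (@RintegralZl _ _ _ m setT _ r measurableT (isn m t)). Qed.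

Lemma ecos_affine a b m t :
  ecos (affine_law a b m) t = cos (t * b) * ecos m (t * a) - sin (t * b) * esin m (t * a).
Proof.
rewrite /ecos /affine_law (@Rintegral_distribution _ _ _ _ _ m (affine a b)
  (fun x => cos (t * x)) 1)//; last first.
  by move=> x; exact: cos_max.
rewrite -ecosZ -esinZ -RintegralB//; last 2 first.
- by apply: (@integrableZl _ _ _ m setT measurableT (cos (t * b)) _ (ic m (t * a))).
- by apply: (@integrableZl _ _ _ m setT measurableT (sin (t * b)) _ (isn m (t * a))).
apply: eq_Rintegral => x _; rewrite /affine mulrDr cosD mulrA.
by rewrite [cos _ * cos _]mulrC [sin _ * sin _]mulrC.
Qed.

Lemma esin_affine a b m t :
  esin (affine_law a b m) t = cos (t * b) * esin m (t * a) + sin (t * b) * ecos m (t * a).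
Proof.
rewrite /esin /affine_law (@Rintegral_distribution _ _ _ _ _ m (affine a b)
  (fun x => sin (t * x)) 1)//; last first.
  by move=> x; exact: sin_max.
rewrite -ecosZ -esinZ -RintegralD//; last 2 first.
- by apply: (@integrableZl _ _ _ m setT measurableT (cos (t * b)) _ (isn m (t * a))).
- by apply: (@integrableZl _ _ _ m setT measurableT (sin (t * b)) _ (ic m (t * a))).
apply: eq_Rintegral => x _; rewrite /affine mulrDr sinD mulrA.
by rewrite [sin _ * cos _]mulrC [cos _ * sin _]mulrC.
Qed.

Lemma char2_affine a b m t : char2 (affine_law a b m) t = char2 m (t * a).
Proof.
rewrite /char2 ecos_affine esin_affine.
have h := cos2Dsin2 (t * b); rewrite -[RHS]mul1r -h; ring.
Qed.

Lemma ecos_conv m1 m2 t :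
  ecos (convolution m1 m2) t = ecos m1 t * ecos m2 t - esin m1 t * esin m2 t.
Proof.
rewrite /ecos /convolution (@Rintegral_distribution _ _ _ _ _ (m1 \x m2)%E addR2
  (fun x => cos (t * x)) 1)//; last first.
  by move=> x; exact: cos_max.
rewrite -(@Rintegral_prod _ _ _ _ _ m1 m2 _ _ 1) //; try by move=> x; exact: cos_max.
rewrite -(@Rintegral_prod _ _ _ _ _ m1 m2 _ _ 1) //; try by move=> x; exact: sin_max.
rewrite -RintegralB//.
- by apply: eq_Rintegral => x _; rewrite /addR2 mulrDr cosD.
- apply: (@bounded_integrable _ _ _ (m1 \x m2)%E _ 1).
    apply: measurable_funM.
      exact: (measurableT_comp (mc t) measurable_fst).
    exact: (measurableT_comp (mc t) measurable_snd).
  by move=> x; rewrite normrM mulr_ile1 ?cos_max.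
- apply: (@bounded_integrable _ _ _ (m1 \x m2)%E _ 1).
    apply: measurable_funM.
      exact: (measurableT_comp (ms t) measurable_fst).
    exact: (measurableT_comp (ms t) measurable_snd).
  by move=> x; rewrite normrM mulr_ile1 ?sin_max.
Qed.

Lemma esin_conv m1 m2 t :
  esin (convolution m1 m2) t = esin m1 t * ecos m2 t + ecos m1 t * esin m2 t.
Proof.
rewrite /esin /convolution (@Rintegral_distribution _ _ _ _ _ (m1 \x m2)%E addR2
  (fun x => sin (t * x)) 1)//; last first.
  by move=> x; exact: sin_max.
rewrite -(@Rintegral_prod _ _ _ _ _ m1 m2 _ _ 1) //; try by move=> x; rewrite ?cos_max ?sin_max.
rewrite -(@Rintegral_prod _ _ _ _ _ m1 m2 _ _ 1) //; try by move=> x; rewrite ?cos_max ?sin_max.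
rewrite -RintegralD//.
- by apply: eq_Rintegral => x _; rewrite /addR2 mulrDr sinD.
- apply: (@bounded_integrable _ _ _ (m1 \x m2)%E _ 1).
    apply: measurable_funM.
      exact: (measurableT_comp (ms t) measurable_fst).
    exact: (measurableT_comp (mc t) measurable_snd).
  by move=> x; rewrite normrM mulr_ile1 ?sin_max ?cos_max.
- apply: (@bounded_integrable _ _ _ (m1 \x m2)%E _ 1).
    apply: measurable_funM.
      exact: (measurableT_comp (mc t) measurable_fst).
    exact: (measurableT_comp (ms t) measurable_snd).
  by move=> x; rewrite normrM mulr_ile1 ?sin_max ?cos_max.
Qed.

Lemma char2_conv m1 m2 t : char2 (convolution m1 m2) t = char2 m1 t * char2 m2 t.
Proof. by rewrite /char2 ecos_conv esin_conv; ring. Qed.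

Lemma char2_conv_pow m n t : char2 (convolution_pow m n) t = char2 m t ^+ n.
Proof.
elim: n => [|n IH]; last by rewrite exprSr -IH /= char2_conv.
rewrite expr0 /char2 /ecos /esin /Rintegral /=.
rewrite !integral_dirac//; last 2 first.
- exact/measurable_EFinP.
- exact/measurable_EFinP.
by rewrite !diracT !mul1e /= mulr0 cos0 sin0 expr1n expr0n addr0.
Qed.

Lemma eq_law_char2 m1 m2 t : eq_law m1 m2 -> char2 m1 t = char2 m2 t.
Proof.
move=> e; rewrite /char2 /ecos /esin /Rintegral.
by congr (fine _ ^+ 2 + fine _ ^+ 2);
  apply: eq_measure_integral => A mA _; exact: e.
Qed.

Lemma char2_0 m : char2 m 0 = 1.
Proof.
rewrite /char2 /ecos /esin; under eq_Rintegral do rewrite mul0r cos0.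
under [X in _ + X ^+ 2]eq_Rintegral do rewrite mul0r sin0.
by rewrite !Rintegral_probability_cst expr1n expr0n addr0.
Qed.

Lemma norm_ecos_le1 m t : `|ecos m t| <= 1.
Proof. by apply: norm_Rintegral_le => // x; exact: cos_max. Qed.
Lemma norm_esin_le1 m t : `|esin m t| <= 1.
Proof. by apply: norm_Rintegral_le => // x; exact: sin_max. Qed.

(** A characteristic function of modulus one at [t] makes [exp (i t x)] almost
    surely constant. Doing this for all [t = 2^-k] leaves a single point: two
    points at distance less than [pi 2^k] are separated by frequency [2^-k]. *)
Lemma char2_eq1_degenerate m : (forall t, char2 m t = 1) -> ~ Defs.nondegenerate m.
Proof.
move=> c1 nd.
pose D t := [set x : R | cos (t * x) = ecos m t /\ sin (t * x) = esin m t].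
have mD t : measurable (D t).
  rewrite (_ : D t = (fun x => cos (t * x)) @^-1` [set ecos m t] `&`
                     (fun x => sin (t * x)) @^-1` [set esin m t])//.
  by apply: measurableI; rewrite -[X in measurable X]setTI; [exact: mc|exact: ms].
have D1 t : m (~` D t) = 0%E.
  pose g x := ecos m t * cos (t * x) + esin m t * sin (t * x).
  have ig : m.-integrable setT (EFin \o g).
    apply: (@integrableD _ _ _ _ _ measurableT (fun x => (ecos m t * cos (t * x))%:E)
      (fun x => (esin m t * sin (t * x))%:E)).
    - exact: (@integrableZl _ _ _ m setT measurableT (ecos m t) _ (ic m t)).
    - exact: (@integrableZl _ _ _ m setT measurableT (esin m t) _ (isn m t)).
  have mg : measurable_fun setT g.
    by apply/measurable_EFinP; exact: (measurable_int m ig).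
  (* [1 - g] is non-negative with zero mean: it is half the squared distance
     between the wave and its mean, both being of modulus one. *)
  have hE x : (1 - g x) *+ 2 =
      (cos (t * x) - ecos m t) ^+ 2 + (sin (t * x) - esin m t) ^+ 2.
    have h1 := cos2Dsin2 (t * x); have h2 := c1 t; rewrite /char2 in h2.
    by rewrite /g; nra.
  have h0 x : 0 <= 1 - g x by rewrite -(pmulrn_lge0 _ (ltn0Sn 1)) hE addr_ge0// sqr_ge0.
  have i1 : m.-integrable setT (EFin \o (fun=> 1 : R)).
    by apply: (@bounded_integrable _ _ _ m (fun=> 1) `|1|).
  have I0 : \int[m]_x (1 - g x) = 0.
    rewrite RintegralB// Rintegral_probability_cst RintegralD//; last 2 first.
    - exact: (@integrableZl _ _ _ m setT measurableT (ecos m t) _ (ic m t)).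
    - exact: (@integrableZl _ _ _ m setT measurableT (esin m t) _ (isn m t)).
    by rewrite ecosZ esinZ -!expr2 -/(char2 m t) c1 subrr.
  have ih : m.-integrable setT (EFin \o (fun x => 1 - g x)).
    exact: (integrableB measurableT i1 ig).
  have [+ _] := ae_eq_integral_abs m measurableT (measurable_int m ih).
  case.
    transitivity (\int[m]_x (1 - g x))%:E; last by rewrite I0.
    rewrite /Rintegral fineK; last exact: integrable_fin_num.
    by apply: eq_integral => x _; rewrite /= ger0_norm.
  move=> N [mN N0 hN]; apply: (@subset_measure0 _ _ _ m _ N) => //.
    exact: measurableC.
  move=> x nDx; apply: hN => /= /(_ I) [] hx; apply: nDx.
  have := hE x; rewrite hx mul0rn => /esym/eqP.
  rewrite paddr_eq0 ?sqr_ge0// !sqrf_eq0 !subr_eq0 => /andP[/eqP hc /eqP hs].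
  by split.
pose G := \bigcap_k D (2^-1 ^+ k).
have mG : measurable G by apply: bigcapT_measurable.
have G1 : m G = 1%E.
  rewrite -[RHS](probability_setT m) -(setUv G) measureU ?setICr//; last exact: measurableC.
  rewrite [X in (_ + X)%E](_ : _ = 0%E) ?adde0//.
  apply/eqP; rewrite eq_le measure_ge0 andbT setC_bigcap.
  apply: le_trans (generalized_Boole_inequality _ _ _) _.
  - by move=> k; exact: measurableC.
  - by apply: bigcup_measurable => k _; exact: measurableC.
  by rewrite eseries0 // => i *; exact: D1.
have [x0 Gx0] : G !=set0.
  apply/set0P/eqP => G0; move: G1; rewrite G0 measure0 => /eqP.
  by rewrite eqe eq_sym oner_eq0.
have GE : G `<=` [set x0].
  move=> x Gx /=.
  have cos1 k : cos (2^-1 ^+ k * (x - x0)) = 1.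
    have [c s] := Gx k I; have [c' s'] := Gx0 k I.
    by rewrite mulrBr cosB c s c' s' -!expr2; exact: c1.
  have [//|ne] := eqVneq x x0.
  have d0 : 0 < `|x - x0| by rewrite normr_gt0 subr_eq0.
  have pi0 := pi_gt0 R.
  have [k hk] : exists k, 2^-1 ^+ k * `|x - x0| <= pi.
    have := @cvg_expr R 2^-1; rewrite ger0_norm// => /(_ ltac:(lra)).
    move=> /cvgrPdist_le /(_ (pi / `|x - x0|)) [].
      by rewrite divr_gt0.
    move=> k _ /(_ k (leqnn k)) /=; rewrite sub0r normrN => h.
    exists k; rewrite -ler_pdivlMr//; apply: le_trans h; exact: ler_norm.
  have : 2^-1 ^+ k * `|x - x0| = 0.
    apply: cos_inj; rewrite ?in_itv/= ?lexx ?(ltW pi0)// ?mulr_ge0 ?exprn_ge0//.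
    rewrite cos0 -[RHS](cos1 k).
    have [h|h] := leP 0 (x - x0); first by rewrite ger0_norm.
    by rewrite ltr0_norm// mulrN cosN.
  by move/eqP; rewrite mulf_eq0 expf_eq0 invr_eq0 pnatr_eq0 andbF/= gt_eqF.
have := nd x0; rewrite -G1 => /eqP; apply.
apply/eqP; rewrite eq_le G1 probability_le1//= -G1; apply: le_measure => //; rewrite inE//.
Qed.

End characteristic.

(** * Tightness and weak convergence *)

Section tightness.
Context {R : realType}.
Implicit Types (m : probability R R).

Definition far (K : R) : set R := [set x | K < `|x|].

Lemma measurable_far K : measurable (far K).
Proof.
rewrite (_ : far K = (fun x : R => `|x|) @^-1` [set x | K < x]); last by [].
rewrite -[X in measurable X]setTI; have mn : measurable_fun setT (fun x : R => `|x|).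
  by apply: continuous_measurable_fun; exact: norm_continuous.
apply: mn => //.
rewrite (_ : [set x | K < x] = `]K, +oo[%classic); first exact: measurable_itv.
by apply/seteqP; split => x /=; rewrite in_itv/= andbT.
Qed.

Lemma tight1 m (e : R) : 0 < e -> exists2 K : R, 0 < K & (m (far K) <= e%:E)%E.
Proof.
move=> e0.
have := @nonincreasing_cvg_mu _ _ _ m (fun k => far k.+1%:R).
rewrite (_ : \bigcap_n _ = set0); last first.
  rewrite -subset0 => x /(_ (Num.truncn `|x|) I).
  by rewrite /far/=; apply/negP; rewrite -leNgt ltW// truncnS_gt.
rewrite measure0 => /(_ _ _ _ _)/fine_cvgP[]//.
- by rewrite (le_lt_trans (probability_le1 _ _)) ?ltry//; exact: measurable_far.
- by move=> k; exact: measurable_far.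
- move=> i j ij; apply/subsetPset => x; rewrite /far/=; apply: le_lt_trans.
  by rewrite ler_nat.
move=> _ /cvgrPdist_le /(_ e e0)[k _ /(_ k (leqnn k))] /=.
rewrite sub0r normrN => h; exists k.+1%:R => //.
rewrite -(fineK (fin_num_measure m _ (measurable_far _))) lee_fin.
by apply: le_trans h; exact: ler_norm.
Qed.

Lemma Rintegral_indic d (T : measurableType d) (P : probability T R) (B : set T) :
  measurable B -> \int[P]_x \1_B x = fine (P B).
Proof. by move=> mB; rewrite /Rintegral integral_indic// setIT. Qed.

Lemma weak_cvg_Rintegral (mu_ : nat -> probability R R) m (f : R -> R) (C : R) :
  weak_cvg mu_ m -> continuous f -> (forall x, `|f x| <= C) ->
  \int[mu_ n]_x f x @[n --> \oo] --> \int[m]_x f x.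
Proof.
move=> w cf fC; have mf : measurable_fun setT f by exact: continuous_measurable_fun.
have bf : bounded_fun f.
  exists C; split; first exact: num_real.
  by move=> M CM x _ /=; apply: (le_trans (fC x)); exact: ltW.
have := w f cf bf.
rewrite -(fineK (x := (\int[m]_x (f x)%:E)%E)); last first.
  by apply: integrable_fin_num => //; exact: (bounded_integrable m mf fC).
by move=> /fine_cvgP[].
Qed.

Lemma tight_seq (mu_ : nat -> probability R R) m (e : R) : weak_cvg mu_ m -> 0 < e ->
  exists2 K : R, 0 < K & \forall n \near \oo, (mu_ n (far K) <= e%:E)%E.
Proof.
move=> w e0; have e20 : 0 < e / 2 by lra.
have [K K0 hK] := tight1 m e20.
(* A continuous function between the indicators of [far (K + 1)] and [far K]. *)
pose f (x : R) : R := Num.min 1 (Num.max 0 (`|x| - K)).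
have cf : continuous f.
  move=> x; apply: (@continuous_min R R (cst 1) (fun x => Num.max 0 (`|x| - K)) x).
    exact: cst_continuous.
  apply: (@continuous_max R R (cst 0) (fun x => `|x| - K) x); first exact: cst_continuous.
  by apply: continuousB; [exact: norm_continuous|exact: cst_continuous].
have f0 x : 0 <= f x by rewrite /f le_min ler01 le_max lexx.
have f1 x : f x <= 1 by rewrite /f ge_min lexx.
have fn x : `|f x| <= 1 by rewrite ger0_norm.
have mf : measurable_fun setT f by exact: continuous_measurable_fun.
have i1 (q : probability R R) B : measurable B -> q.-integrable setT (EFin \o (\1_B : R -> R)).
  by move=> mB; exact: integrable_indic.
exists (K + 1); first by rewrite addr_gt0.
have := @weak_cvg_Rintegral mu_ m f 1 w cf fn.
move=> /cvgrPdist_lt /(_ _ e20); apply: filterS => n hn.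
have mB := measurable_far (K + 1).
rewrite -(fineK (fin_num_measure (mu_ n) _ mB)) lee_fin -Rintegral_indic//.
apply: (@le_trans _ _ (\int[mu_ n]_x f x)).
  apply: le_Rintegral => //; [exact: i1|exact: (bounded_integrable _ mf fn)|].
  move=> x _; rewrite indicE; have [|] := boolP (x \in far (K + 1)); last by rewrite f0.
  rewrite inE /far/= => h; rewrite /f le_min lexx/= le_max; apply/orP; right; lra.
have : \int[m]_x f x <= e / 2.
  rewrite -lee_fin; apply: le_trans hK.
  rewrite -(fineK (fin_num_measure m _ (measurable_far K))) lee_fin.
  rewrite -Rintegral_indic//; last exact: measurable_far.
  apply: le_Rintegral => //.
  - exact: (bounded_integrable _ mf fn).
  - by apply: i1; exact: measurable_far.
  move=> x _; rewrite indicE; have [|] := boolP (x \in far K); first by rewrite f1.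
  rewrite notin_setE /far/= => /negP; rewrite -leNgt => h.
  rewrite /f ge_min; apply/orP; right; rewrite ge_max lexx/=; lra.
by move: hn; rewrite ltr_norml => /andP[]; lra.
Qed.

Lemma cos_lip (a b : R) : `|cos a - cos b| <= `|a - b|.
Proof.
wlog ab : a b / a < b => [hw|].
  have [ab|ab|->] := ltgtP a b; first exact: hw.
    by rewrite distrC [leRHS]distrC; exact: hw.
  by rewrite !subrr.
have [|c _ h] := @MVT R cos (fun x => - sin x) a b ab _.
  by apply: continuous_subspaceT => x; exact: continuous_cos.
rewrite distrC h normrM normrN [leRHS]distrC ler_piMl//; exact: sin_max.
Qed.

Lemma sin_lip (a b : R) : `|sin a - sin b| <= `|a - b|.
Proof.
wlog ab : a b / a < b => [hw|].
  have [ab|ab|->] := ltgtP a b; first exact: hw.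
    by rewrite distrC [leRHS]distrC; exact: hw.
  by rewrite !subrr.
have [|c _ h] := @MVT R sin cos a b ab _.
  by apply: continuous_subspaceT => x; exact: continuous_sin.
rewrite distrC h normrM [leRHS]distrC ler_piMl//; exact: cos_max.
Qed.

(** On [[-K, K]] the wave is Lipschitz in its frequency with constant [K], and
    on the tail the two waves differ by at most 2. This makes characteristic
    functions equicontinuous along a tight sequence. *)
Lemma wave_close m (f : R -> R) (K e s t : R) : 0 <= K ->
  continuous f -> (forall x, `|f x| <= 1) -> (forall a b, `|f a - f b| <= `|a - b|) ->
  (m (far K) <= e%:E)%E ->
  `|\int[m]_x f (s * x) - \int[m]_x f (t * x)| <= `|s - t| * K + 2 * e.
Proof.
move=> K0 cf f1 fl hK.
have mf r : measurable_fun setT (fun x : R => f (r * x)).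
  apply: measurableT_comp; first exact: continuous_measurable_fun.
  exact: measurable_funM.
have i r : m.-integrable setT (EFin \o (fun x => f (r * x))).
  exact: (bounded_integrable m (mf r) (fun x => f1 _)).
have mB := measurable_far K.
rewrite -RintegralB//; apply: le_trans (le_normr_Rintegral measurableT _) _.
  exact: (integrableB measurableT (i s) (i t)).
have d2 x : `|f (s * x) - f (t * x)| <= 2.
  by rewrite (le_trans (ler_normB _ _))// (le_trans (lerD (f1 _) (f1 _))); lra.
have ib : m.-integrable setT (EFin \o (fun x => `|s - t| * K + 2 * \1_(far K) x)).
  apply: (@bounded_integrable _ _ _ m _ (`|s - t| * K + 2)).
    by apply: measurable_funD => //; apply: measurable_funM => //; exact: measurable_indic.
  move=> x; rewrite indicE ger0_norm ?addr_ge0 ?mulr_ge0//.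
  by rewrite lerD2l ler_piMr// lern1 leq_b1.
apply: (@le_trans _ _ (\int[m]_x (`|s - t| * K + 2 * \1_(far K) x))).
  apply: le_Rintegral => //.
    apply: (@bounded_integrable _ _ _ m _ 2); last by move=> x; rewrite normr_id.
    by apply: measurableT_comp => //; exact: measurable_funB.
  move=> x _; rewrite indicE; have [|] := boolP (x \in far K).
    by move=> _; rewrite mulr1 (le_trans (d2 x))// lerDr mulr_ge0.
  rewrite notin_setE /far/= => /negP; rewrite -leNgt => h.
  by rewrite mulr0 addr0 (le_trans (fl _ _))// -mulrBl normrM ler_wpM2l.
rewrite RintegralD//; last 2 first.
- exact: (@bounded_integrable _ _ _ m (fun=> `|s - t| * K) (`| `|s - t| * K |)).
- apply: (@bounded_integrable _ _ _ m _ 2).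
    by apply: measurable_funM => //; exact: measurable_indic.
  by move=> x; rewrite indicE ger0_norm ?mulr_ge0// ler_piMr// lern1 leq_b1.
rewrite Rintegral_probability_cst lerD2l RintegralZl//; last exact: integrable_indic.
rewrite Rintegral_indic// ler_wpM2l//.
by rewrite -lee_fin fineK// fin_num_measure.
Qed.

Lemma char2_close m (K e s t : R) : 0 <= K -> (m (far K) <= e%:E)%E ->
  `|char2 m s - char2 m t| <= 4 * (`|s - t| * K + 2 * e).
Proof.
move=> K0 hK.
have c := @wave_close m cos K e s t K0 (@continuous_cos R) (@cos_max R) cos_lip hK.
have n := @wave_close m sin K e s t K0 (@continuous_sin R) (@sin_max R) sin_lip hK.
rewrite -/(ecos m s) -/(ecos m t) in c; rewrite -/(esin m s) -/(esin m t) in n.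
rewrite /char2.
have -> : ecos m s ^+ 2 + esin m s ^+ 2 - (ecos m t ^+ 2 + esin m t ^+ 2) =
  (ecos m s - ecos m t) * (ecos m s + ecos m t) +
  (esin m s - esin m t) * (esin m s + esin m t) by ring.
apply: le_trans (ler_normD _ _) _; rewrite !normrM.
have hc : `|ecos m s + ecos m t| <= 2.
  by apply: le_trans (ler_normD _ _) _; have := norm_ecos_le1 m s; have := norm_ecos_le1 m t; lra.
have hn : `|esin m s + esin m t| <= 2.
  by apply: le_trans (ler_normD _ _) _; have := norm_esin_le1 m s; have := norm_esin_le1 m t; lra.
have := ler_pM (normr_ge0 _) (normr_ge0 _) c hc.
have := ler_pM (normr_ge0 _) (normr_ge0 _) n hn.
lra.
Qed.

Lemma char2_le2 m t : 0 <= char2 m t <= 2.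
Proof.
have := norm_ecos_le1 m t; have := norm_esin_le1 m t.
rewrite !ler_norml /char2 => /andP[a b] /andP[c e]; nra.
Qed.

Lemma char2_cvg (mu_ : nat -> probability R R) m t : weak_cvg mu_ m ->
  char2 (mu_ n) t @[n --> \oo] --> char2 m t.
Proof.
move=> w.
have cc : continuous (fun x : R => cos (t * x)).
  by move=> x; apply: continuous_comp; [exact: mulrl_continuous|exact: continuous_cos].
have cs : continuous (fun x : R => sin (t * x)).
  by move=> x; apply: continuous_comp; [exact: mulrl_continuous|exact: continuous_sin].
have hc := @weak_cvg_Rintegral _ _ _ 1 w cc (fun x => cos_max _).
have hs := @weak_cvg_Rintegral _ _ _ 1 w cs (fun x => sin_max _).
rewrite /char2 !expr2.
by apply: cvgD; apply: cvgM.
Qed.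

End tightness.

(** * Normalizations in the domain of attraction of a stable law *)

Section stable_domain.
Context {R : realType}.
Variables (nu : probability int R) (A : nat -> R) (beta : R) (mu : probability R R).
Hypothesis A_gt0 : forall n, 0 < A n.
Hypothesis A_mono : forall m n, (m <= n)%N -> A m <= A n.
Hypothesis beta_gt1 : 1 < beta.
Hypothesis mu_stable : Defs.stable beta mu.
Hypothesis nu_cvg : weak_cvg (fun n => normalized_sum_law nu n (A n)) mu.

Let S n := convolution_pow (real_law nu) n.
Let kappa : R := 2 `^ beta^-1.

Lemma leq_double_self n : (n <= n.*2)%N.
Proof. by rewrite -addnn leq_addr. Qed.

Lemma kappa_itv : 1 < kappa < 2.
Proof.
have b0 : 0 < beta^-1 by rewrite invr_gt0 (lt_trans ltr01).
have l2 : 0 < ln 2 :> R by rewrite ln_gt0// ltr1n.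
rewrite /kappa /powR pnatr_eq0/= expR_gt1 mulr_gt0//=.
rewrite -[ltRHS]lnK ?posrE// ltr_expR -[ltRHS]mul1r ltr_pM2r//.
by rewrite invf_lt1// (lt_trans ltr01).
Qed.

(** Stability for two equal weights: the law of a sum of two independent copies
    is, up to centering, the law dilated by [kappa = 2^(1/beta)]. *)
Lemma stable_char2 t : char2 mu (kappa * t) = char2 mu t ^+ 2.
Proof.
have [_ /(_ 1 1 ltr01 ltr01)[c /(eq_law_char2 t)]] := mu_stable.
rewrite char2_conv !char2_affine powR1 mulr1 -expr2 => ->.
by rewrite mulrC.
Qed.

Lemma normalized_char2 n t : char2 (normalized_sum_law nu n (A n)) t =
  char2 (real_law nu) (t / A n) ^+ n.
Proof. by rewrite /normalized_sum_law char2_affine char2_conv_pow. Qed.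

Lemma normalized_char2_double n t :
  char2 (normalized_sum_law nu n.*2 (A n.*2)) t =
  char2 (normalized_sum_law nu n (A n)) (t * (A n / A n.*2)) ^+ 2.
Proof.
rewrite !normalized_char2 -exprM muln2; congr (char2 _ _ ^+ _).
by rewrite -mulrA; congr (_ * _); rewrite mulrAC divff ?mul1r// gt_eqF.
Qed.

(** If [A (2 n) > r A n] for infinitely many [n], let [theta <= r^-1] be a
    cluster point of the ratios [A n / A (2 n)]. Passing to the limit in
    [normalized_char2_double] and combining with [stable_char2] gives
    [char2 mu t = char2 mu (q t)] with [q = kappa theta < 1]; iterating,
    [char2 mu] is constant equal to 1, and [mu] is degenerate. *)
Lemma normalization_double (r : R) : kappa < r ->
  \forall n \near \oo, A n.*2 <= r * A n.
Proof.
move=> kr; have /andP[k1 k2] := kappa_itv.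
have r0 : 0 < r by lra.
apply: contrapT => nr.
pose th n := A n / A n.*2.
have bad n0 : exists2 n, (n0 <= n)%N & th n \in `[0, r^-1].
  apply: contrapT => nex; apply: nr; exists n0 => // n n0n /=.
  rewrite leNgt; apply/negP => h; apply: nex; exists n => //.
  rewrite in_itv/=; apply/andP; split; first by rewrite divr_ge0// ltW.
  by rewrite ler_pdivrMr// mulrC ler_pdivlMr// mulrC ltW.
(* Bad indices give ratios in the compact interval [[0, r^-1]]; the filter of
   their tails has a cluster point [theta] there. *)
pose F : set_system R := [set B | exists n0, forall n, (n0 <= n)%N ->
  th n \in `[0, r^-1] -> B (th n)].
have FF : ProperFilter F.
  split; first by move=> [n0 h]; have [n /h] := bad n0.
  split.
  - by exists 0%N.
  - move=> B C [n1 h1] [n2 h2]; exists (maxn n1 n2) => n; rewrite geq_max => /andP[a b] c.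
    by split; [exact: h1|exact: h2].
  - by move=> B C BC [n1 h1]; exists n1 => n a b; apply: BC; exact: h1.
have Fs : F `[0, r^-1]%classic by exists 0%N.
have [theta [th01 clth]] := @segment_compact R 0 r^-1 F FF Fs.
have theta_near (eta : R) n0 : 0 < eta -> exists2 n, (n0 <= n)%N & `|th n - theta| < eta.
  move=> eta0.
  have := clth [set y | exists2 n, (n0 <= n)%N & y = th n] (ball theta eta).
  case; first by exists n0 => n n0n _; exists n.
    exact: nbhsx_ballx.
  by move=> y [[n n0n ->]]; rewrite /ball/= distrC => h; exists n.
have key t : char2 mu t = char2 mu (t * theta) ^+ 2.
  apply/eqP; rewrite -subr_eq0 -normr_eq0 eq_le normr_ge0 andbT.
  apply/ler_addgt0Pr => /= d d0; rewrite add0r.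
  (* 53 = 1 + 13 * 4: an error [e] on [char2 mu t], and an error [13 e] on
     [char2 mu (t * theta)] multiplied by a sum of two values at most 2. *)
  pose e : R := d / 53; have e0 : 0 < e by rewrite divr_gt0.
  have [K K0 [n2 _ hn2]] := tight_seq nu_cvg e0.
  have /cvgrPdist_le/(_ e e0)[n3 _ hn3] := @char2_cvg _ _ _ t nu_cvg.
  have /cvgrPdist_le/(_ e e0)[n4 _ hn4] := @char2_cvg _ _ _ (t * theta) nu_cvg.
  pose eta : R := e / ((`|t| + 1) * K).
  have tK : 0 < (`|t| + 1) * K by rewrite mulr_gt0// ltr_wpDl.
  have eta0 : 0 < eta by rewrite divr_gt0.
  have [n hn hth] := theta_near eta (maxn n2 (maxn n3 n4)) eta0.
  move: hn; rewrite !geq_max => /and3P[n2n n3n n4n].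
  have /= h3 := hn3 n.*2 (leq_trans n3n (leq_double_self n)).
  have /= h4 := hn4 n n4n.
  have h2 := char2_close (t * th n) (t * theta) (ltW K0) (hn2 n n2n).
  rewrite normalized_char2_double -/(th n) in h3.
  set a := char2 _ (t * th n) in h2 h3; set b := char2 _ (t * theta) in h2 h4.
  set c := char2 mu (t * theta) in h4 *; set f := char2 mu t in h3 *.
  have h5 : `|t * th n - t * theta| * K <= e.
    rewrite -mulrBr normrM; apply: (@le_trans _ _ ((`|t| + 1) * eta * K)).
      by rewrite ler_wpM2r ?(ltW K0)// ler_pM ?lerDl// ltW.
    by rewrite mulrAC mulrC /eta divfK// gt_eqF.
  have h6 : `|a - b| <= 12 * e by lra.
  have /andP[a0 a2] : 0 <= a <= 2 by exact: char2_le2.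
  have /andP[c0 c2] : 0 <= c <= 2 by exact: char2_le2.
  have h7 : `|a - c| <= 13 * e.
    rewrite (_ : a - c = (a - b) + (b - c)); last by ring.
    by apply: le_trans (ler_normD _ _) _; have := h4; rewrite distrC; lra.
  rewrite (_ : f - c ^+ 2 = (f - a ^+ 2) + (a - c) * (a + c)); last by ring.
  apply: le_trans (ler_normD _ _) _; rewrite normrM.
  have h8 : `|a + c| <= 4 by rewrite ler_norml; apply/andP; split; lra.
  have := ler_pM (normr_ge0 _) (normr_ge0 _) h7 h8.
  rewrite /e in h3 *; lra.
have theta0 : 0 <= theta <= r^-1 by move: th01; rewrite /= in_itv.
have /andP[t0 tr] := theta0.
pose q := kappa * theta.
have q0 : 0 <= q by rewrite mulr_ge0//; lra.
have q1 : q < 1.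
  apply: (@le_lt_trans _ _ (kappa / r)); first by rewrite ler_pM2l//; lra.
  by rewrite ltr_pdivrMr// mul1r.
have scale t k : char2 mu t = char2 mu (t * q ^+ k).
  elim: k => [|k IH]; first by rewrite expr0 mulr1.
  rewrite IH key -stable_char2; congr (char2 _ _); rewrite /q exprSr; ring.
apply: (@char2_eq1_degenerate _ mu); last by case: mu_stable.
move=> t; apply/eqP; rewrite -subr_eq0 -normr_eq0 eq_le normr_ge0 andbT.
apply/ler_addgt0Pr => /= d d0; rewrite add0r.
(* 12 = 4 * (1 + 2), from [char2_close] with [|t q^k| K <= e]. *)
pose e : R := d / 12; have e0 : 0 < e by rewrite divr_gt0.
have [K K0 hK] := tight1 mu e0.
have [k hk] : exists k, `|t * q ^+ k| * K <= e.
  have := @cvg_expr R q; rewrite ger0_norm// => /(_ q1).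
  have tK : 0 < (`|t| + 1) * K by rewrite mulr_gt0// ltr_wpDl.
  move=> /cvgrPdist_le /(_ (e / ((`|t| + 1) * K))) [].
    by rewrite divr_gt0.
  move=> k _ /(_ k (leqnn k)) /=; rewrite sub0r normrN => h.
  exists k; rewrite ler_pdivlMr// in h; apply: le_trans h.
  by rewrite normrM mulrAC mulrC ler_wpM2l// ler_wpM2r ?(ltW K0)// lerDl.
rewrite (scale t k) -(char2_0 mu).
apply: le_trans (char2_close _ _ (ltW K0) hK) _.
rewrite subr0 /e in hk *; lra.
Qed.

(** Iterating [normalization_double] from a large [n1] gives
    [A (n1 2^j) <= r^j A n1] with [r] half-way between [kappa] and 2. Tightness
    of the normalized sums then controls all large [k], and the finitely many
    small [k] are absorbed in the constant [C]. *)
Lemma vertical_scale : exists r n1 (C : R), [/\ 1 <= r < 2, (0 < n1)%N, 0 < C &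
  forall j k, (k <= n1 * 2 ^ j)%N ->
    (convolution_pow (real_law nu) k (far (C * r ^+ j)) <= 4^-1%:E)%E].
Proof.
have /andP[k1 k2] := kappa_itv.
pose r := (kappa + 2) / 2; have kr : kappa < r by rewrite /r; lra.
have r2 : r < 2 by rewrite /r; lra.
have [n2 _ hn2] := normalization_double kr.
pose n1 := n2.+1.
have A_pow j : A (n1 * 2 ^ j) <= r ^+ j * A n1.
  elim: j => [|j IH]; first by rewrite expn0 muln1 expr0 mul1r.
  have n2j : (n2 <= n1 * 2 ^ j)%N.
    by rewrite (leq_trans (leqnSn n2))// leq_pmulr// expn_gt0.
  rewrite expnS mulnCA mul2n (le_trans (hn2 _ n2j))// exprS -mulrA.
  by rewrite ler_wpM2l//; lra.
have q0 : 0 < 4^-1 :> R by lra.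
have [K0 K00 [n3 _ hn3]] := tight_seq nu_cvg q0.
have [K1 K10 hK1] : exists2 K1 : R, 0 < K1 & forall k, (k < n3)%N -> (S k (far K1) <= 4^-1%:E)%E.
  elim: (n3) => [|n [K1 K10 hK1]]; first by exists 1.
  have [K2 K20 hK2] := tight1 (S n) q0.
  exists (K1 + K2); first exact: addr_gt0.
  have sub K : K \in [:: K1; K2] -> far (K1 + K2) `<=` far K.
    by rewrite !inE => /orP[] /eqP-> x /=; apply: le_lt_trans; rewrite ?lerDl ?lerDr ltW.
  move=> k; rewrite ltnS leq_eqVlt => /orP[/eqP->|kn].
    apply: le_trans hK2; apply: le_measure; rewrite ?inE; try exact: measurable_far.
    by apply: sub; rewrite !inE eqxx orbT.
  apply: le_trans (hK1 _ kn); apply: le_measure; rewrite ?inE; try exact: measurable_far.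
  by apply: sub; rewrite !inE eqxx.
exists r, n1, (K1 + K0 * A n1); split => //.
- by apply/andP; split => //; lra.
- by rewrite addr_gt0// mulr_gt0.
move=> j k kj.
have rj1 : 1 <= r ^+ j by rewrite exprn_ege1//; lra.
have KA : 0 < K0 * A n1 by rewrite mulr_gt0.
have [kn3|n3k] := ltnP k n3.
  apply: le_trans (hK1 _ kn3); apply: le_measure; rewrite ?inE; try exact: measurable_far.
  move=> x /=; apply: le_lt_trans.
  rewrite (@le_trans _ _ ((K1 + K0 * A n1) * 1))//; first by rewrite mulr1 lerDl ltW.
  by rewrite ler_wpM2l// addr_ge0// ltW.
apply: le_trans (hn3 k n3k).
rewrite /normalized_sum_law /affine_law /distribution /pushforward.
apply: le_measure; rewrite ?inE; first exact: measurable_far.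
  rewrite -[X in measurable X]setTI.
  exact: (measurable_affine (A k)^-1 0 measurableT (measurable_far K0)).
move=> x /= h; rewrite /far/= /affine addr0 normrM normfV (gtr0_norm (A_gt0 k)) mulrC.
rewrite ltr_pdivlMr//; apply: le_lt_trans h.
rewrite mulrDl -mulrA; apply: (@le_trans _ _ (K0 * (A n1 * r ^+ j))).
  by rewrite ler_wpM2l ?(ltW K00)// mulrC (le_trans (A_mono kj)).
by rewrite lerDr mulr_ge0 ?(ltW K10)//; lra.
Qed.

End stable_domain.

Section convolution_shift.
Context {R : realType} (nu : probability int R).
Let S n : probability R R := convolution_pow (real_law nu) n.

Lemma convolution_pow_shift k (B : set R) : measurable B ->
  S k.+1 B = (\int[nu]_z S k [set x | B (x + z%:~R)%R])%E.
Proof.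
move=> mB.
have mA : measurable (addR2 @^-1` B : set (R * R)).
  by rewrite -[X in measurable X]setTI; exact: (measurable_addR2 measurableT mB).
have mI : measurable_fun setT (fun z : R * R => (\1_(addR2 @^-1` B) z)%:E : \bar R).
  by apply/measurable_EFinP; exact: measurable_indic.
have -> : S k.+1 B = (\int[(S k \x real_law nu)%E]_z (\1_(addR2 @^-1` B) z)%:E)%E.
  by rewrite integral_indic// setIT.
rewrite (fubini_tonelli2 _ mI); last by move=> z; rewrite lee_fin.
have mG := measurable_fun_fubini_tonelli_G (m1 := S k) _ mI (fun z => ltac:(rewrite lee_fin//)).
rewrite (ge0_integral_distribution intR mG); last first.
  by move=> y; apply: integral_ge0 => x _; rewrite lee_fin.
apply: eq_integral => z _ /=; rewrite /fubini_G -[in RHS](setIT [set x | _]).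
rewrite -integral_indic//; last first.
  rewrite -[X in measurable X]setTI.
  have : measurable_fun setT (fun x : R => x + z%:~R) by exact: measurable_funD.
  by move=> /(_ measurableT _ mB).
Qed.

End convolution_shift.

(** * Independence of disjoint families of coordinates *)

Section independence.
Context d (Omega : measurableType d) (R : realType) (P : probability Omega R).
Variable X : int -> {RV P >-> R}.
Hypothesis X_indep : mutually_independent X.

Definition cylinder (I : set int) : set (set Omega) := [set F |
  exists (J : {fset int}) (B : int -> set R),
    [/\ (forall i, i \in J -> I i), (forall i, measurable (B i)) &
        F = \bigcap_(i in [set` J]) (X i @^-1` B i)]].

Definition generated (I : set int) : set (set Omega) := <<s cylinder I >>.

Lemma cylinder_measurable I : cylinder I `<=` measurable.
Proof.
move=> _ [J [B [_ mB ->]]]; apply: fin_bigcap_measurable => // i _.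
by rewrite -[X in measurable X]setTI; exact: (measurable_funP (X i)).
Qed.

Lemma generated_measurable I : generated I `<=` measurable.
Proof.
apply: smallest_sub; [exact: sigma_algebra_measurable|exact: cylinder_measurable].
Qed.

Lemma cylinderT I : cylinder I setT.
Proof.
exists fset0, (fun=> setT); split => //.
by apply/esym/seteqP; split => // t _ i; rewrite /= in_fset0.
Qed.

Lemma cylinder_setI I : setI_closed (cylinder I).
Proof.
move=> _ _ [J [B [JI mB ->]]] [J' [B' [JI' mB' ->]]].
exists (J `|` J')%fset, (fun i => (if i \in J then B i else setT) `&`
  (if i \in J' then B' i else setT)); split.
- by move=> i; rewrite in_fsetU => /orP[/JI|/JI'].
- by move=> i; apply: measurableI; case: ifP.
apply/seteqP; split => t /=.
  move=> [h h'] i /= _; split; case: ifP => // iJ; [exact: h|exact: h'].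
move=> h; split => i /= iJ.
  by have [] := h i; rewrite /= ?in_fsetU ?iJ.
by have [] := h i; rewrite /= ?in_fsetU ?iJ ?orbT.
Qed.

Lemma cylinder_indep I I' F G : I `&` I' = set0 -> cylinder I F -> cylinder I' G ->
  P (F `&` G) = (P F * P G)%E.
Proof.
move=> II' [J [B [JI mB ->]]] [J' [B' [JI' mB' ->]]].
pose C i := if i \in J then B i else B' i.
have disj i : i \in J -> i \in J' -> False.
  move=> /JI iI /JI' iI'; suff : (I `&` I') i by rewrite II'.
  by [].
rewrite !X_indep//.
have -> : \bigcap_(i in [set` J]) X i @^-1` B i `&` \bigcap_(i in [set` J']) X i @^-1` B' i =
   \bigcap_(i in [set` (J `|` J')%fset]) X i @^-1` C i.
  apply/seteqP; split => t /=.
    move=> [h h'] i /=; rewrite in_fsetU /C; case: ifP => iJ /=; first by move=> _; exact: h.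
    by move=> iJ'; exact: h'.
  move=> h; split => i /= iJ; have := h i; rewrite /= in_fsetU /C iJ ?orbT.
    by apply.
  by case: ifP => [/disj/(_ iJ)//|_]; apply.
rewrite X_indep; last by move=> i; rewrite /C; case: ifP.
rewrite (perm_big (enum_fset J ++ enum_fset J')).
  rewrite big_cat/=; congr (_ * _)%E; rewrite !big_seq; apply: eq_bigr => i iJ.
    by rewrite /C iJ.
  by rewrite /C; case: ifP => // /disj/(_ iJ).
apply: uniq_perm; first exact: fset_uniq.
  rewrite cat_uniq !fset_uniq /= andbT; apply/hasPn => i iJ'.
  by apply/negP => /disj/(_ iJ').
by move=> i; rewrite mem_cat in_fsetU.
Qed.

(** For fixed [G], both sides are finite measures in [F] that agree on the
    cylinders, which are stable under intersection. *)
Lemma extend_indep I (G : set Omega) : measurable G ->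
  (forall F, cylinder I F -> P (F `&` G) = (P F * P G)%E) ->
  forall F, generated I F -> P (F `&` G) = (P F * P G)%E.
Proof.
move=> mG h F gF.
have G0 : (0 <= fine (P G))%R by rewrite fine_ge0.
pose m1 : {measure set Omega -> \bar R} := mrestr P mG.
pose m2 : {measure set Omega -> \bar R} := mscale (NngNum G0) P.
have m1E C : m1 C = P (C `&` G) by [].
have m2E C : m2 C = (P C * P G)%E.
  by rewrite -[LHS]/((fine (P G))%:E * P C)%E fineK ?fin_num_measure// muleC.
rewrite -m1E -m2E.
apply: (g_sigma_algebra_measure_unique (cylinder I) (@cylinder_measurable I) (fun=> setT)) => //.
- by move=> _; exact: cylinderT.
- by rewrite bigcup_const.
- exact: cylinder_setI.
- by move=> C cC; rewrite m1E m2E; exact: h.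
- move=> _; rewrite m1E setTI (le_lt_trans (probability_le1 P mG))//.
  by rewrite ltry.
Qed.

Lemma generated_indep I I' F G : I `&` I' = set0 -> generated I F -> generated I' G ->
  P (F `&` G) = (P F * P G)%E.
Proof.
move=> II' gF gG; have mF := generated_measurable gF.
have mG := generated_measurable gG.
apply: (@extend_indep I) => // {F gF mF} F cF.
rewrite setIC muleC; apply: (@extend_indep I') => //.
  exact: cylinder_measurable cF.
by move=> C cC; rewrite setIC muleC; exact: (cylinder_indep II').
Qed.

Lemma generated_sub I I' : I `<=` I' -> generated I `<=` generated I'.
Proof.
move=> II'; apply: smallest_sub; first exact: smallest_sigma_algebra.
move=> F [J [B [JI mB ->]]]; apply: sub_gen_smallest.
by exists J, B; split => // i /JI; exact: II'.
Qed.

Definition depends_on (I : set int) (Y : Omega -> R) : Prop :=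
  measurable_fun (setT : set (g_sigma_algebraType (cylinder I))) Y.

Lemma depends_on_coord (I : set int) i : I i -> depends_on I (X i).
Proof.
move=> Ii _ B mB; rewrite setTI; apply: sub_sigma_algebra.
exists [fset i]%fset, (fun=> B); split => //.
  by move=> k; rewrite in_fset1 => /eqP ->.
apply/seteqP; split => t /=.
  by move=> h k; rewrite /= in_fset1 => /eqP ->.
by apply; rewrite /= in_fset1.
Qed.

Lemma depends_on_preimage I Y B : depends_on I Y -> measurable B ->
  generated I (Y @^-1` B).
Proof. by move=> dY mB; have := dY measurableT _ mB; rewrite setTI. Qed.

Lemma depends_on_measurable I Y : depends_on I Y -> measurable_fun setT Y.
Proof.
move=> dY _ B mB; rewrite setTI; apply: generated_measurable.
exact: (depends_on_preimage dY).
Qed.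

Lemma depends_on_sub I I' Y : I `<=` I' -> depends_on I Y -> depends_on I' Y.
Proof.
move=> II' dY _ B mB; rewrite setTI; apply: (generated_sub II').
exact: (depends_on_preimage dY).
Qed.

End independence.

Section product_expectation.
Context d (Omega : measurableType d) (R : realType) (P : probability Omega R).

Lemma Rintegral_indep (Y Z : Omega -> R) (C : R) :
  measurable_fun setT Y -> measurable_fun setT Z ->
  (forall A B, measurable A -> measurable B ->
    P (Y @^-1` A `&` Z @^-1` B) = (P (Y @^-1` A) * P (Z @^-1` B))%E) ->
  (forall w, `|Y w| <= C) -> (forall w, `|Z w| <= C) ->
  \int[P]_w (Y w * Z w) = (\int[P]_w Y w) * (\int[P]_w Z w).
Proof.
move=> mY mZ ind YC ZC.
pose Y' : {mfun Omega >-> R} := HB.pack Y (isMeasurableFun.Build _ _ _ _ Y mY).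
pose Z' : {mfun Omega >-> R} := HB.pack Z (isMeasurableFun.Build _ _ _ _ Z mZ).
have mYZ : measurable_fun setT (fun w => (Y w, Z w)) by exact: measurable_fun_pair.
pose YZ : {mfun Omega >-> (R * R)%type} :=
  HB.pack (fun w => (Y w, Z w)) (isMeasurableFun.Build _ _ _ _ (fun w => (Y w, Z w)) mYZ).
(* The product formula under a product measure is for bounded functions on the
   line; [clip] is one that agrees with the identity on the values of [Y], [Z]. *)
pose clip (x : R) := x * \1_[set x | `|x| <= C] x.
have C0 : 0 <= C := bound_ge0 P YC.
have mclip : measurable_fun setT clip.
  apply: measurable_funM => //; apply: measurable_indic.
  rewrite (_ : [set x | _] = ~` (far C)); first by apply: measurableC; exact: measurable_far.
  by apply/seteqP; split => x /=; rewrite /far/= leNgt => /negP.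
have clip_le x : `|clip x| <= C.
  rewrite /clip indicE; have [|] := boolP (x \in _).
    by rewrite inE mulr1.
  by rewrite mulr0 normr0.
have clipK x : `|x| <= C -> clip x = x.
  by move=> xC; rewrite /clip indicE mem_set// mulr1.
have joint : forall S, measurable S ->
    (distribution P Y' \x distribution P Z')%E S = distribution P YZ S.
  apply: product_measure_unique => A B mA mB.
  by rewrite -ind.
transitivity (\int[distribution P YZ]_z (clip z.1 * clip z.2)).
  rewrite (@Rintegral_distribution _ _ _ _ _ P YZ _ (C * C)).
  - by apply: eq_Rintegral => w _ /=; rewrite !clipK.
  - by apply: measurable_funM; apply: measurableT_comp.
  - by move=> z; rewrite normrM ler_pM.
transitivity (\int[(distribution P Y' \x distribution P Z')%E]_z (clip z.1 * clip z.2)).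
  rewrite /Rintegral; congr fine; apply: eq_measure_integral => S mS _.
  exact: (esym (joint S mS)).
rewrite (@Rintegral_prod _ _ _ _ _ _ _ clip clip C)//.
rewrite !(@Rintegral_distribution _ _ _ _ _ P _ _ C)//.
by congr (_ * _); apply: eq_Rintegral => w _; rewrite clipK.
Qed.

End product_expectation.

(** * Gambler's ruin for a walk stopped at the exit of an interval *)

Section stopped_walk.
Context {R : realType}.
Implicit Types (l H : R).

Definition inside l H (v : R) : bool := - l < v < H.

(** The walk is frozen at its first value outside [(-l, H)]. *)
Fixpoint stopped T l H (Y : nat -> T -> R) n (w : T) : R :=
  if n is k.+1 then
    stopped l H Y k w + (inside l H (stopped l H Y k w))%:R * Y k w
  else 0.

Fixpoint walk (y : nat -> R) n : R := if n is k.+1 then walk y k + y k else 0.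

Lemma stopped_path T l H (Y : nat -> T -> R) n (w : T) : 0 < l -> 0 < H ->
  H <= stopped l H Y n w ->
  exists c, [/\ (c <= n)%N, H <= walk (Y^~ w) c &
    forall i, (i <= c)%N -> - l < walk (Y^~ w) i].
Proof.
move=> l0 H0.
set y := Y^~ w; set W := fun k => stopped l H Y k w.
have WS k : W k.+1 = W k + (inside l H (W k))%:R * y k by [].
have : [\/ (forall i, (i <= n)%N -> inside l H (walk y i)) /\ W n = walk y n,
   exists c, [/\ (c <= n)%N, H <= walk y c & forall i, (i <= c)%N -> - l < walk y i] |
   W n <= - l].
  elim: n => [|n IH].
    constructor 1; split => // i; rewrite leqn0 => /eqP ->.
    by rewrite /inside/= oppr_lt0 l0 H0.
  case: IH => [[ins Wn]|[c [cn Hc hc]]|Wn]; last 2 first.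
  - by constructor 2; exists c; split => //; exact: leqW.
  - constructor 3; rewrite WS (_ : inside l H (W n) = false) ?mul0r ?addr0//.
    by rewrite /inside ltNge Wn.
  have WSn : W n.+1 = walk y n.+1 by rewrite WS Wn ins//= mul1r.
  have ge i : (i <= n)%N -> - l < walk y i by move=> /ins/andP[].
  have [h1|h1] := lerP H (walk y n.+1).
    constructor 2; exists n.+1; split => // i; rewrite leq_eqVlt => /orP[/eqP ->|/ge//].
    by rewrite (lt_le_trans _ h1)// (lt_trans _ H0)// oppr_lt0.
  have [h2|h2] := lerP (walk y n.+1) (- l); first by constructor 3; rewrite WSn.
  constructor 1; split => // i; rewrite leq_eqVlt => /orP[/eqP ->|/ins//].
  by rewrite /inside h1 h2.
case => [[ins Wn]|//|Wn] HW; rewrite -/(W n) in HW.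
- by have := ins n (leqnn n); rewrite -Wn /inside [X in _ && X]ltNge HW andbF.
- by exfalso; lra.
Qed.

Section expectation.
Context d (Omega : measurableType d) (P : probability Omega R).
Variables (Y : nat -> Omega -> R) (K sigma2 l H : R).
Hypothesis mY : forall k, measurable_fun setT (Y k).
Hypothesis YK : forall k w, `|Y k w| <= K.
Hypothesis EY : forall k, \int[P]_w Y k w = 0.
Hypothesis EY2 : forall k, \int[P]_w (Y k w ^+ 2) = sigma2.
Hypotheses (l_gt0 : 0 < l) (H_gt0 : 0 < H) (sigma2_gt0 : 0 < sigma2).
Hypothesis Y_indep : forall k A B, measurable A -> measurable B ->
  P (stopped l H Y k @^-1` A `&` Y k @^-1` B) =
  (P (stopped l H Y k @^-1` A) * P (Y k @^-1` B))%E.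

Let W k := stopped l H Y k.
Let ins k w : R := (inside l H (W k w))%:R.
Let K_ge0 : 0 <= K.
Proof. exact: (bound_ge0 P (YK 0%N)). Qed.

Lemma measurable_inside : measurable_fun setT (fun v : R => (inside l H v)%:R : R).
Proof.
rewrite (_ : (fun _ => _) = \1_(`]- l, H[%classic) :> (R -> R)); last first.
  apply/funext => v; rewrite indicE; case: (boolP (inside l H v)) => h.
    by rewrite mem_set//= in_itv.
  by rewrite memNset//= in_itv; exact/negP.
by apply: measurable_indic; exact: measurable_itv.
Qed.

Lemma measurable_stopped k : measurable_fun setT (W k).
Proof.
elim: k => [|k IH]; first exact: measurable_cst.
apply: measurable_funD => //; apply: measurable_funM => //.
exact: (measurableT_comp measurable_inside IH).
Qed.

Lemma measurable_ins k : measurable_fun setT (ins k).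
Proof.
exact: (measurableT_comp measurable_inside (measurable_stopped k)).
Qed.

Let ins_le1 k w : 0 <= ins k w <= 1.
Proof. by rewrite /ins ler0n lern1 leq_b1. Qed.

Let L := l + H + K.

Lemma stopped_range k w : - l - K <= W k w <= H + K.
Proof.
have K0 := K_ge0; have l0 := l_gt0; have H0 := H_gt0.
elim: k => [|k IH]; first by rewrite /W /=; lra.
rewrite /W/= -/(W k w); have := YK k w; rewrite ler_norml => /andP[y1 y2].
case: (boolP (inside _ _ _)) => [/andP[h1 h2]|_]; rewrite ?mul1r ?mul0r ?addr0//.
by apply/andP; split; lra.
Qed.

Lemma stopped_bound k w : `|W k w| <= L.
Proof.
have := stopped_range k w; have := l_gt0; have := H_gt0; rewrite ler_norml /L.
by move=> ? ? /andP[? ?]; lra.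
Qed.

Let L_ge0 : 0 <= L. Proof. by rewrite /L; have := K_ge0; have := l_gt0; have := H_gt0; lra. Qed.

Lemma indep_product k (f g : R -> R) (C : R) : measurable_fun setT f ->
  measurable_fun setT g -> (forall w, `|f (W k w)| <= C) -> (forall w, `|g (Y k w)| <= C) ->
  \int[P]_w (f (W k w) * g (Y k w)) = (\int[P]_w f (W k w)) * (\int[P]_w g (Y k w)).
Proof.
move=> mf mg fC gC; apply: (@Rintegral_indep _ _ _ _ (f \o W k) (g \o Y k) C) => //.
- by apply: measurableT_comp => //; exact: measurable_stopped.
- exact: measurableT_comp.
move=> A B mA mB; apply: (@Y_indep k (f @^-1` A) (g @^-1` B)).
  by rewrite -[X in measurable X]setTI; exact: mf.
by rewrite -[X in measurable X]setTI; exact: mg.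
Qed.

Let ib (f : Omega -> R) C : measurable_fun setT f -> (forall w, `|f w| <= C) ->
  P.-integrable setT (EFin \o f).
Proof. exact: bounded_integrable. Qed.

Let mf := measurable_inside.

Lemma stopped_mean k : \int[P]_w W k w = 0.
Proof.
elim: k => [|k IH]; first by rewrite Rintegral_probability_cst.
have b w : `|ins k w * Y k w| <= K.
  have /andP[i0 i1] := ins_le1 k w.
  by rewrite normrM (ger0_norm i0) -[leRHS]mul1r ler_pM.
rewrite /W/= -/(W k) RintegralD//; last 2 first.
- exact: (ib (measurable_stopped k) (stopped_bound k)).
- by apply: (ib _ b); apply: measurable_funM => //; exact: measurable_ins.
rewrite IH add0r (@indep_product k (fun v => (inside l H v)%:R) id (1 + K))//.
- by rewrite EY mulr0.
- move=> w; have /andP[i0 i1] := ins_le1 k w.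
  by rewrite (ger0_norm i0) (le_trans i1)// lerDl.
- by move=> w; rewrite (le_trans (YK k w))// lerDr.
Qed.

(** Conditionally on the past, the cross term has mean zero: only the variance
    of a step taken inside the interval is added. *)
Lemma stopped_square k :
  \int[P]_w (W k.+1 w ^+ 2) = \int[P]_w (W k w ^+ 2) + sigma2 * \int[P]_w ins k w.
Proof.
have mi := measurable_ins k; have mW := measurable_stopped k.
have bWi w : `|2 * W k w * ins k w| <= 2 * L.
  have /andP[i0 i1] := ins_le1 k w.
  rewrite !normrM (ger0_norm i0) ger0_norm// -[leRHS]mulr1 ler_pM ?mulr_ge0//.
  by rewrite ler_pM2l//; exact: stopped_bound.
have bWiY w : `|(2 * W k w * ins k w) * Y k w| <= 2 * L * K.
  by rewrite normrM ler_pM.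
have bY2 w : `|Y k w ^+ 2| <= K ^+ 2.
  by rewrite normrX lerXn2r// ?nnegrE.
have biY w : `|ins k w * Y k w ^+ 2| <= K ^+ 2.
  have /andP[i0 i1] := ins_le1 k w.
  by rewrite normrM (ger0_norm i0) -[leRHS]mul1r ler_pM.
have bW2 w : `|W k w ^+ 2| <= L ^+ 2.
  by rewrite normrX lerXn2r// ?nnegrE//; exact: stopped_bound.
have iW2 := ib (measurable_funX 2 mW) bW2.
have mWi : measurable_fun setT (fun w => 2 * W k w * ins k w).
  by apply: measurable_funM => //; exact: measurable_funM.
have iWiY := ib (measurable_funM mWi (mY k)) bWiY.
have iiY := ib (measurable_funM mi (measurable_funX 2 (mY k))) biY.
transitivity (\int[P]_w (W k w ^+ 2 + ((2 * W k w * ins k w) * Y k w + ins k w * Y k w ^+ 2))).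
  apply: eq_Rintegral => w _; rewrite /W/= -/(W k w) /ins.
  by case: (inside _ _ _) => /=; ring.
rewrite RintegralD//; last exact: (integrableD measurableT iWiY iiY).
congr (_ + _); rewrite RintegralD//.
rewrite (@indep_product k (fun v => 2 * v * (inside l H v)%:R) id (2 * L + K))//; last 3 first.
- by apply: measurable_funM; [exact: measurable_funM|exact: mf].
- by move=> w; rewrite (le_trans (bWi w))// lerDl.
- by move=> w; rewrite (le_trans (YK k w))// lerDr mulr_ge0.
rewrite EY mulr0 add0r.
rewrite (@indep_product k (fun v => (inside l H v)%:R) (fun v => v ^+ 2) (1 + K ^+ 2))//.
- by rewrite EY2 mulrC.
- move=> w; have /andP[i0 i1] := ins_le1 k w.
  by rewrite (ger0_norm i0) (le_trans i1)// lerDl exprn_ge0.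
- by move=> w; rewrite (le_trans (bY2 w))// lerDr.
Qed.

Lemma ins_decr k w : ins k.+1 w <= ins k w.
Proof.
rewrite /ins /W/= -/(W k w).
case: (boolP (inside l H (W k w))) => /= h; first by rewrite lern1 leq_b1.
by rewrite mul0r addr0 (negbTE h).
Qed.

(** The second moment stays below [L^2] but increases by [sigma2] at each step
    with the probability of still being inside, which is non-increasing. *)
Lemma inside_le n : sigma2 * n%:R * \int[P]_w ins n w <= L ^+ 2.
Proof.
have ii k : P.-integrable setT (EFin \o ins k).
  apply: (ib (C := 1) (measurable_ins k)) => w.
  by have /andP[i0 i1] := ins_le1 k w; rewrite ger0_norm.
have dec k : \int[P]_w ins k.+1 w <= \int[P]_w ins k w.
  by apply: le_Rintegral => // w _; exact: ins_decr.
have i0 k : 0 <= \int[P]_w ins k w.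
  by apply: Rintegral_ge0 => w _; case/andP: (ins_le1 k w).
apply: (@le_trans _ _ (\int[P]_w (W n w ^+ 2))).
  elim: n => [|n IH].
    by rewrite mulr0 mul0r; apply: Rintegral_ge0 => w _; exact: sqr_ge0.
  rewrite stopped_square -natr1 mulrDr mulr1 mulrDl; apply: lerD.
    by apply: le_trans IH; apply: ler_wpM2l => //; rewrite mulr_ge0// ltW.
  by rewrite ler_pM2l.
have bW2 w : `|W n w ^+ 2| <= L ^+ 2.
  by rewrite normrX lerXn2r// ?nnegrE//; exact: stopped_bound.
apply: le_trans (ler_norm _) _; apply: norm_Rintegral_le => //.
exact/measurable_funX/measurable_stopped.
Qed.

(** The stopped walk is a bounded martingale started at 0. Pointwise
    [W n <= L 1_(W n >= H) + L 1_(inside) - l], since a walk that has exited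
    below is at most [-l]; taking expectations gives
    [l <= L P (W n >= H) + L P (inside)], and [inside_le] bounds the last
    probability by [L^2 / (sigma2 n)]. *)
Lemma exit_above n :
  sigma2 * n%:R * (l - L * fine (P [set w | H <= W n w])) <= L ^+ 3.
Proof.
have mA : measurable [set w | H <= W n w].
  rewrite (_ : [set w | _] = W n @^-1` `[H, +oo[%classic); last first.
    by apply/seteqP; split => w /=; rewrite in_itv/= andbT.
  by rewrite -[X in measurable X]setTI; exact: (measurable_stopped n).
rewrite -Rintegral_indic//; set p := \int[P]_w _; set q := \int[P]_w ins n w.
have i1 : P.-integrable setT (EFin \o (\1_[set w | H <= W n w] : Omega -> R)).
  exact: integrable_indic.
have i2 : P.-integrable setT (EFin \o ins n).
  apply: (ib (C := 1) (measurable_ins n)) => w.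
  by have /andP[i0 i1'] := ins_le1 n w; rewrite ger0_norm.
have i3 : P.-integrable setT (EFin \o W n) := ib (measurable_stopped n) (stopped_bound n).
have i4 : P.-integrable setT (EFin \o (fun w => L * \1_[set w | H <= W n w] w)).
  exact: (@integrableZl _ _ _ P setT measurableT L _ i1).
have i5 : P.-integrable setT (EFin \o (fun w => L * ins n w)).
  exact: (@integrableZl _ _ _ P setT measurableT L _ i2).
have i45 : P.-integrable setT (EFin \o (fun w => L * \1_[set w | H <= W n w] w + L * ins n w)).
  exact: (integrableD measurableT i4 i5).
have il : P.-integrable setT (EFin \o (fun _ : Omega => l)).
  by apply: (@bounded_integrable _ _ _ P (fun=> l) `|l|).
have key : 0 <= L * p + L * q - l.
  rewrite -(stopped_mean n).
  have -> : L * p + L * q - l = \int[P]_w ((L * \1_[set w | H <= W n w] w + L * ins n w) - l).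
    rewrite RintegralB// RintegralD// Rintegral_probability_cst.
    by rewrite RintegralZl// RintegralZl.
  apply: le_Rintegral => //; first exact: (integrableB measurableT i45 il).
  move=> w _; have /andP[r1 r2] := stopped_range n w.
  have K0 := K_ge0; have l0 := l_gt0; have H0 := H_gt0.
  rewrite indicE /ins /inside.
  have [HW|WH] := lerP H (W n w).
    by rewrite mem_set//= andbF mulr1 mulr0 /L; lra.
  rewrite memNset/=; last by apply/negP; rewrite -ltNge.
  have [h|h] := ltrP (- l) (W n w); rewrite /= ?mulr1 ?mulr0 /L; lra.
have hq := inside_le n; rewrite -/q in hq.
have n0 : 0 <= sigma2 * n%:R by rewrite mulr_ge0// ltW.
apply: (@le_trans _ _ (sigma2 * n%:R * (L * q))).
  by apply: ler_wpM2l => //; lra.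
rewrite mulrCA exprS; exact: ler_wpM2l.
Qed.

End expectation.
End stopped_walk.

(** * The potential of an environment *)

Section potential.
Context {R : realType}.
Implicit Types (u : int -> R) (y : nat -> R).

Definition log_odds u x := ln ((1 - u x) / u x).

Definition potential u (x : int) : R :=
  match x with
  | Posz n => walk (fun i => log_odds u i.+1%:Z) n
  | Negz n => walk (fun i => - log_odds u (- i%:Z)) n.+1
  end.

Lemma potentialN u n : potential u (- n%:Z) = walk (fun i => - log_odds u (- i%:Z)) n.
Proof. by case: n => [|n]; rewrite ?oppr0// -NegzE. Qed.

Lemma potentialS u x : potential u (x + 1) = potential u x + log_odds u (x + 1).
Proof.
case: x => n.
  by rewrite (_ : n%:Z + 1 = n.+1%:Z)//; lia.
rewrite NegzE (_ : - n.+1%:Z + 1 = - n%:Z); last by lia.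
by rewrite !potentialN /= subrK.
Qed.

Lemma walkD y L i : walk y (L + i) = walk y L + walk (fun t => y (L + t)%N) i.
Proof. by elim: i => [|i IH]; rewrite ?addn0 ?addr0// addnS /= IH addrA. Qed.

Lemma walk_le y (K : R) n : (forall i, `|y i| <= K) -> `|walk y n| <= K * n%:R.
Proof.
move=> yK; elim: n => [|n IH]; first by rewrite normr0 mulr0.
by rewrite /= -natr1 mulrDr mulr1 (le_trans (ler_normD _ _))// lerD.
Qed.

(** Before the block the walk is within [a j / 2] of 0, because the scale [j]
    is a large multiple of the number [L] of sites already explored. Climbing
    to [2 j] before descending by [a j / 2] within the block then reaches the
    height [2 j - a j / 2 >= j] without ever going below [- a j]. *)
Lemma barrier_after_block T (w : T) y (Y : nat -> T -> R) (K a j : R) (L n : nat) :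
  0 < a <= 1 -> 0 < j -> (forall i, `|y i| <= K) -> K * L%:R <= a / 2 * j ->
  (forall t, Y t w = y (L + t)%N) ->
  2 * j <= stopped (a / 2 * j) (2 * j) Y n w ->
  exists c, [/\ (c <= L + n)%N, j <= walk y c &
    forall i, (i <= c)%N -> - (a * j) <= walk y i].
Proof.
move=> /andP[a0 a1] j0 yK KL Yy h.
have l0 : 0 < a / 2 * j by rewrite mulr_gt0//; lra.
have H0 : 0 < 2 * j by lra.
have [c [cn Hc hc]] := stopped_path l0 H0 h.
have aj : a * j <= j by rewrite -[leRHS]mul1r ler_pM2r.
have Yw i : walk (Y^~ w) i = walk (fun t => y (L + t)%N) i.
  by elim: i => //= i ->; rewrite Yy.
have wL k : (k <= L)%N -> - (a / 2 * j) <= walk y k <= a / 2 * j.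
  move=> kL; rewrite -ler_norml (le_trans (walk_le k yK))// (le_trans _ KL)//.
  rewrite ler_wpM2l ?ler_nat//; exact: le_trans (yK 0%N).
have /andP[wL1 wL2] := wL L (leqnn L).
exists (L + c)%N; split; first by rewrite leq_add2l.
  by rewrite walkD -Yw; lra.
move=> i ic; have [iL|Li] := leqP i L.
  by have /andP[h1 _] := wL i iL; lra.
have -> : i = (L + (i - L))%N by rewrite subnKC// ltnW.
rewrite walkD -Yw; have := hc (i - L)%N; rewrite leq_subLR => /(_ ic); lra.
Qed.

End potential.

(** * Barriers in a random environment *)

Section environment.
Context d (Omega : measurableType d) (R : realType) (P : probability Omega R).
Variable omega : int -> {RV P >-> R}.
Hypothesis omega01 : forall x w, 0 < omega x w < 1.
Hypothesis omega_iid : iid omega.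
Hypothesis Elogrho : ('E_P[fun w => ln (rho omega 0%R w)] = 0)%E.
Hypothesis Vlogrho : (0 < 'V_P[fun w => ln (rho omega 0%R w)])%E.
Variable eps : R.
Hypothesis eps_itv : 0 < eps < 2^-1.
Hypothesis elliptic : P [set w | eps <= omega 0 w <= 1 - eps] = 1%E.

(** Truncated to the almost sure range of the environment, so as to be bounded
    everywhere and not only almost everywhere. *)
Definition logit (v : R) : R := (ln (1 - v) - ln v) * \1_(`[eps, 1 - eps]%classic) v.

Lemma logitE v : eps <= v <= 1 - eps -> logit v = ln ((1 - v) / v).
Proof.
move=> h; have /andP[h1 h2] := h; have /andP[e0 e1] := eps_itv.
rewrite /logit indicE mem_set ?mulr1/= ?in_itv//= ln_div ?posrE//; lra.
Qed.

Definition logit_bound : R := ln ((1 - eps) / eps).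

Lemma logit_le v : `|logit v| <= logit_bound.
Proof.
have /andP[e0 e1] := eps_itv.
have q0 : 0 < (1 - eps) / eps by rewrite divr_gt0//; lra.
have q1 : 1 <= (1 - eps) / eps by rewrite ler_pdivlMr//; lra.
case: (boolP (eps <= v <= 1 - eps)) => h; last first.
  rewrite /logit indicE memNset/= ?in_itv; last exact/negP.
  by rewrite mulr0 normr0 ln_ge0.
rewrite logitE//; have /andP[h1 h2] := h.
have v0 : 0 < v by lra.
have v1 : 0 < 1 - v by lra.
have e2 : 0 < 1 - eps by lra.
rewrite ler_norml; apply/andP; split.
  rewrite /logit_bound -lnV ?posrE// ler_ln ?posrE ?invr_gt0 ?divr_gt0//.
  rewrite invf_div ler_pdivrMr; last lra.
  rewrite mulrAC ler_pdivlMr//; nra.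
rewrite ler_ln ?posrE ?divr_gt0// ler_pdivrMr// mulrAC ler_pdivlMr//; nra.
Qed.

Lemma measurable_logit : measurable_fun setT logit.
Proof.
apply: measurable_funM; last by apply: measurable_indic; exact: measurable_itv.
apply: measurable_funB; last exact: measurable_ln.
by apply: measurableT_comp; [exact: measurable_ln|exact: measurable_funB].
Qed.

Lemma all_elliptic x : P [set w | eps <= omega x w <= 1 - eps] = 1%E.
Proof.
rewrite -elliptic; have [_ id] := omega_iid.
have : P (omega x @^-1` `[eps, 1 - eps]%classic) = P (omega 0 @^-1` `[eps, 1 - eps]%classic).
  exact: (id x 0 `[eps, 1 - eps]%classic (measurable_itv _)).
have E y : omega y @^-1` `[eps, 1 - eps]%classic = [set w | eps <= omega y w <= 1 - eps].
  by apply/seteqP; split => w /=; rewrite in_itv.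
by rewrite !E.
Qed.

Let measurable_elliptic x : measurable [set w | eps <= omega x w <= 1 - eps].
Proof.
rewrite (_ : [set w | _] = omega x @^-1` `[eps, 1 - eps]%classic); last first.
  by apply/seteqP; split => w /=; rewrite in_itv.
by rewrite -[X in measurable X]setTI; exact: (measurable_funP (omega x)).
Qed.

Lemma logrhoE w : ln (rho omega 0 w) = ln (1 - omega 0 w) - ln (omega 0 w).
Proof. by have /andP[a b] := omega01 0 w; rewrite /rho ln_div ?posrE// subr_gt0. Qed.

Let mlogrho : measurable_fun setT (fun w => ln (rho omega 0 w)).
Proof.
rewrite (_ : (fun _ => _) = fun w => ln (1 - omega 0 w) - ln (omega 0 w)); last first.
  by apply/funext => w; exact: logrhoE.
apply: measurable_funB; apply: measurableT_comp => //; try exact: measurable_ln.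
exact: measurable_funB.
Qed.

Let mlogit0 : measurable_fun setT (fun w => logit (omega 0 w)).
Proof. by apply: measurableT_comp; [exact: measurable_logit|]. Qed.

Lemma ae_elliptic x : P.-negligible (~` [set w | eps <= omega x w <= 1 - eps]).
Proof.
exists (~` [set w | eps <= omega x w <= 1 - eps]); split => //.
  exact: measurableC.
by rewrite probability_setC// all_elliptic subee.
Qed.

Lemma logit_mean0 : \int[P]_w logit (omega 0 w) = 0.
Proof.
have := Elogrho; rewrite unlock => E0.
rewrite /Rintegral -[RHS]/(fine 0%E) -E0; congr fine.
apply: ae_eq_integral => //; try exact/measurable_EFinP.
apply: negligibleS (ae_elliptic 0) => w /= h1 h2; apply: h1 => _.
by rewrite logitE.
Qed.

Definition logit_var : R := \int[P]_w (logit (omega 0 w) ^+ 2).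

Lemma logit_var_gt0 : 0 < logit_var.
Proof.
have := Vlogrho; rewrite /variance unlock Elogrho /=.
have -> : ('E_P[(fun w => (ln (rho omega 0 w) - 0) * (ln (rho omega 0 w) - 0))%R] =
           \int[P]_w (logit (omega 0 w) ^+ 2)%:E)%E.
  rewrite unlock; apply: ae_eq_integral => //.
  - by apply/measurable_EFinP; apply: measurable_funM; exact: measurable_funB.
  - by apply/measurable_EFinP; exact: measurable_funX.
  - apply: negligibleS (ae_elliptic 0) => w /= h1 h2; apply: h1 => _.
    by rewrite logitE// subr0 expr2.
move=> h; rewrite -lte_fin /logit_var /Rintegral fineK//.
apply: integrable_fin_num => //.
apply: (@bounded_integrable _ _ _ P _ (logit_bound ^+ 2)).
  exact: measurable_funX.
by move=> w; rewrite normrX lerXn2r ?nnegrE//; [exact: le_trans (logit_le 0)|exact: logit_le].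
Qed.

Lemma Rintegral_site x (f : R -> R) (C : R) : measurable_fun setT f -> (forall v, `|f v| <= C) ->
  \int[P]_w f (omega x w) = \int[P]_w f (omega 0 w).
Proof.
move=> mf fC.
rewrite -(@Rintegral_distribution _ _ _ _ _ P (omega x) f C)//.
rewrite -(@Rintegral_distribution _ _ _ _ _ P (omega 0) f C)//.
rewrite /Rintegral; congr fine; apply: eq_measure_integral => A mA _.
by have [_ id] := omega_iid; exact: id.
Qed.

Lemma logit_mean x : \int[P]_w logit (omega x w) = 0.
Proof.
by rewrite (Rintegral_site x measurable_logit logit_le) logit_mean0.
Qed.

Lemma logit_square x : \int[P]_w (logit (omega x w) ^+ 2) = logit_var.
Proof.
apply: (@Rintegral_site x (fun v => logit v ^+ 2) (logit_bound ^+ 2)).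
  by apply: measurable_funX; exact: measurable_logit.
by move=> v; rewrite normrX lerXn2r ?nnegrE//; [exact: le_trans (logit_le 0)|exact: logit_le].
Qed.

(** The sites on one side of the origin are explored outwards in the order
    [idx]. The sign [s] is [-1] on the left, where moving outwards subtracts
    the log-odds from the potential. *)
Section block.
Variables (idx : nat -> int) (s : R) (l H : R).
Hypothesis idx_inj : injective idx.
Hypothesis s_sign : s = 1 \/ s = -1.
Hypotheses (l_gt0 : 0 < l) (H_gt0 : 0 < H).

Let Y k w := s * logit (omega (idx k) w).
Let sites n : set int := [set x | exists2 i, (i < n)%N & x = idx i].

Lemma step_depends k : depends_on omega [set idx k] (Y k).
Proof.
have dk : depends_on omega [set idx k] (omega (idx k)) by exact: depends_on_coord.
rewrite /depends_on /Y; apply: measurable_funM => //.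
exact: (measurableT_comp measurable_logit dk).
Qed.

Lemma block_depends n : depends_on omega (sites n) (stopped l H Y n).
Proof.
elim: n => [|n IH]; first exact: measurable_cst.
have sub1 : sites n `<=` sites n.+1.
  by move=> x [i il ->]; exists i => //; exact: leqW.
have sub2 : [set idx n] `<=` sites n.+1 by move=> x ->; exists n.
have d1 := depends_on_sub sub1 IH; have d2 := depends_on_sub sub2 (@step_depends n).
rewrite /depends_on in d1 d2 *.
apply: measurable_funD => //; apply: measurable_funM => //.
exact: (measurableT_comp (measurable_inside l H) d1).
Qed.

Definition block_event n : set Omega := [set w | H <= stopped l H Y n w].

Lemma block_event_generated n : generated omega (sites n) (block_event n).
Proof.
have := depends_on_preimage (@block_depends n) (measurable_itv `[H, +oo[).
by congr generated; apply/seteqP; split => w /=; rewrite in_itv/= andbT.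
Qed.

Lemma block_prob n :
  logit_var * n%:R * (l - (l + H + logit_bound) * fine (P (block_event n))) <=
  (l + H + logit_bound) ^+ 3.
Proof.
have s1 : `|s| = 1 by case: s_sign => ->; rewrite ?normrN normr1.
have mY k : measurable_fun setT (Y k).
  exact: (depends_on_measurable (@step_depends k)).
have mlo x : measurable_fun setT (fun w => logit (omega x w)).
  by apply: measurableT_comp; [exact: measurable_logit|].
apply: exit_above => //.
- by move=> k w; rewrite /Y normrM s1 mul1r; exact: logit_le.
- move=> k; rewrite /Y RintegralZl//; first by rewrite logit_mean mulr0.
  exact: (@bounded_integrable _ _ _ P _ _ (mlo _) (fun w => logit_le _)).
- move=> k; rewrite -(logit_square (idx k)); apply: eq_Rintegral => w _.
  by rewrite /Y exprMn; case: s_sign => ->; rewrite ?sqrrN expr1n mul1r.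
- exact: logit_var_gt0.
- move=> k A B mA mB.
  have [ind _] := omega_iid.
  apply: (@generated_indep _ _ _ _ _ ind (sites k) [set idx k]).
  + by rewrite -subset0 => x [[i ik ->] /= /idx_inj ii]; rewrite ii ltnn in ik.
  + exact: (depends_on_preimage (@block_depends k)).
  + exact: (depends_on_preimage (@step_depends k)).
Qed.

End block.

(** With [l = a j / 2] and [H = 2 j], the total width in [exit_above] is at most
    [4 j] for large [j], and with [j^4] steps the error term becomes at most
    half of [l]; what remains is [a j / 4 <= 4 j p]. *)
Lemma block_prob_lower (a : R) : 0 < a <= 1 -> exists j0 : nat, (0 < j0)%N /\
  forall j idx s, (j0 <= j)%N -> injective idx -> s = 1 \/ s = -1 ->
  a / 16 <= fine (P (block_event idx s (a / 2 * j%:R) (2 * j%:R) (j ^ 4))).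
Proof.
move=> /andP[a0 a1]; have s0 := logit_var_gt0.
pose B := 256 / (logit_var * a).
have B0 : 0 <= B by rewrite divr_ge0// mulr_ge0// ltW.
pose j0 := (Num.truncn (logit_bound + B)).+1.
exists j0; split => // j idx s j0j inj sgn.
have K0 : 0 <= logit_bound by exact: le_trans (logit_le 0).
have jB : logit_bound + B <= j%:R.
  by apply: (@le_trans _ _ j0%:R); [exact/ltW/truncnS_gt|rewrite ler_nat].
have j1 : 1 <= j%:R :> R by rewrite ler1n (leq_trans _ j0j).
set J := j%:R : R in jB j1 *; have J0 : 0 < J by lra.
have l0 : 0 < a / 2 * J by rewrite mulr_gt0//; lra.
have H0 : 0 < 2 * J by lra.
have := @block_prob idx s _ _ inj sgn l0 H0 (j ^ 4).
set p := fine _; rewrite natrX -/J; set Lam := _ + logit_bound => h.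
have p0 : 0 <= p by rewrite fine_ge0.
have aJ : a * J <= J by rewrite -[leRHS]mul1r ler_pM2r.
have Lam4 : Lam <= 4 * J by rewrite /Lam; lra.
have Lam0 : 0 <= Lam by rewrite /Lam; lra.
have h2 : logit_var * J ^+ 4 * (a / 2 * J - Lam * p) <= 64 * J ^+ 3.
  apply: (le_trans h); rewrite (_ : 64 = 4 ^+ 3); last by ring.
  by rewrite -exprMn lerXn2r// nnegrE//; lra.
have h3 : logit_var * J * (a / 2 * J - Lam * p) <= 64.
  rewrite -(ler_pM2r (exprn_gt0 3 J0)); apply: le_trans h2.
  by rewrite le_eqVlt; apply/orP; left; apply/eqP; ring.
have h4 : 256 <= logit_var * a * J.
  rewrite -ler_pdivrMl ?mulr_gt0// mulrC -/B; lra.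
have h5 : a / 2 * J - Lam * p <= a / 4 * J.
  rewrite -(ler_pM2l (mulr_gt0 s0 J0)); apply: (le_trans h3).
  by apply: (@le_trans _ _ (logit_var * a * J / 4 * J)); nra.
have h6 : Lam * p <= 4 * J * p by rewrite ler_wpM2r.
by rewrite -(ler_pM2r J0); lra.
Qed.

Section blocks.
Variables (a : R) (D j0 : nat).

(** The [k]-th blocks consist of [scale k ^ 4] new sites on each side, just
    outside the [start k] sites already explored. The scale is at
    least [D * start k], which makes the explored part of the potential negligible,
    and at
    least [k], which makes it tend to infinity. *)
Fixpoint start k : nat :=
  if k is k'.+1 then (start k' + (D * start k' + j0 + k') ^ 4)%N else 0%N.
Definition scale k : nat := (D * start k + j0 + k)%N.

Definition right_site k i : int := (start k + i).+1%:Z.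
Definition left_site k i : int := - (start k + i)%:Z.

Definition barriers k : set Omega :=
  block_event (right_site k) 1 (a / 2 * (scale k)%:R) (2 * (scale k)%:R) (scale k ^ 4) `&`
  block_event (left_site k) (-1) (a / 2 * (scale k)%:R) (2 * (scale k)%:R) (scale k ^ 4).

Let rsites k := [set x | exists2 i, (i < scale k ^ 4)%N & x = right_site k i].
Let lsites k := [set x | exists2 i, (i < scale k ^ 4)%N & x = left_site k i].
Let explored k := [set x : int | - (start k)%:Z < x <= (start k)%:Z].

Lemma start_le k m : (k <= m)%N -> (start k <= start m)%N.
Proof.
elim: m => [|m IH]; first by rewrite leqn0 => /eqP ->.
rewrite leq_eqVlt => /orP[/eqP -> //|/IH h] /=.
by rewrite (leq_trans h)// leq_addr.
Qed.

Lemma barriers_generated k : generated omega (rsites k `|` lsites k) (barriers k).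
Proof.
apply: (@measurableI _ (g_sigma_algebraType (cylinder omega (rsites k `|` lsites k)))).
- apply: generated_sub (@block_event_generated (right_site k) 1 _ _ _).
  by move=> x; left.
- apply: generated_sub (@block_event_generated (left_site k) (-1) _ _ _).
  by move=> x; right.
Qed.

Lemma barriers_explored k m : (k < m)%N -> generated omega (explored m) (barriers k).
Proof.
move=> km; apply: generated_sub (@barriers_generated k).
have := start_le km; rewrite /= -/(scale k) => h.
by move=> x [[i ik ->]|[i ik ->]]; rewrite /explored /right_site /left_site /=; lia.
Qed.

Hypothesis q_lower : forall j idx s, (j0 <= j)%N -> injective idx -> s = 1 \/ s = -1 ->
  a / 16 <= fine (P (block_event idx s (a / 2 * j%:R) (2 * j%:R) (j ^ 4))).
Hypothesis a_itv : 0 < a <= 1.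

Let q := (a / 16) ^+ 2.

Lemma barriers_prob k : q <= fine (P (barriers k)).
Proof.
have [ind _] := omega_iid.
have jk : (j0 <= scale k)%N by rewrite /scale; lia.
have injr : injective (right_site k) by rewrite /right_site => i i' []; lia.
have injl : injective (left_site k).
  by rewrite /left_site => i i' /eqP; rewrite eqr_opp => /eqP []; lia.
have pr := q_lower jk injr (or_introl erefl).
have pl := q_lower jk injl (or_intror erefl).
rewrite /barriers (@generated_indep _ _ _ _ _ ind (rsites k) (lsites k)).
- rewrite fineM ?fin_num_measure//; try by apply: (generated_measurable (X := omega));
    exact: block_event_generated.
  have /andP[a0 _] := a_itv.
  by rewrite /q expr2 ler_pM//; lra.
- rewrite -subset0 => x [[i ik ->] [i' ik']]; rewrite /right_site /left_site; lia.
- exact: block_event_generated.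
- exact: block_event_generated.
Qed.

(** Successive blocks use disjoint sites, so their failures multiply. Recording
    the sites on which the failures depend makes the induction go through. *)
Lemma no_barriers_prob m r :
  generated omega (explored (m + r)%N) (\bigcap_(i in `I_r) ~` barriers (m + i)%N) /\
  fine (P (\bigcap_(i in `I_r) ~` barriers (m + i)%N)) <= (1 - q) ^+ r.
Proof.
have [ind _] := omega_iid.
have /andP[a0 a1] := a_itv.
have q01 : 0 <= q <= 1.
  rewrite /q sqr_ge0 /= expr_le1 ?ltn0Sn//; lra.
have gC I F : generated omega I F -> generated omega I (~` F).
  exact: (@measurableC _ (g_sigma_algebraType (cylinder omega I))).
elim: r => [|r [g IH]].
  rewrite II0 bigcap_set0 probability_setT expr0; split => //.
  exact: (@measurableT _ (g_sigma_algebraType (cylinder omega _))).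
rewrite IIS bigcap_setU bigcap_set1; split.
  apply: (@measurableI _ (g_sigma_algebraType (cylinder omega _))).
    apply: generated_sub g => x; rewrite /explored /=.
    by have := @start_le (m + r)%N (m + r.+1)%N ltac:(lia); lia.
  by apply: gC; apply: barriers_explored; lia.
have gb := gC _ _ (@barriers_generated (m + r)%N).
rewrite (@generated_indep _ _ _ _ _ ind _ _ _ _ _ g gb); last first.
  rewrite -subset0 => x [] e [] [i ik E]; move: e;
    rewrite E /explored /right_site /left_site/=; lia.
have mg := generated_measurable g; have mb := generated_measurable gb.
rewrite fineM ?fin_num_measure// exprSr ler_pM ?fine_ge0//.
have mB := generated_measurable (@barriers_generated (m + r)%N).
have := barriers_prob (m + r)%N; rewrite probability_setC// fineB ?fin_num_measure//=.
lra.
Qed.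

(** Success of each block has probability at least [q > 0] independently of the
    earlier ones, so an infinite run of failures has probability at most
    [(1 - q)^r] for all [r]. *)
Lemma barriers_infinitely_often :
  {ae P, forall w, forall m, exists2 k, (m <= k)%N & barriers k w}.
Proof.
have /andP[a0 a1] := a_itv.
have q01 : 0 < q <= 1.
  rewrite /q exprn_gt0 ?expr_le1 ?ltn0Sn//=; lra.
have /andP[q0 q1] := q01.
suff N0 : P.-negligible (\bigcup_m \bigcap_k ~` barriers (m + k)%N).
  apply: negligibleS N0 => w /= /existsNP[m nm]; exists m => // k _ /= Bk; apply: nm.
  by exists (m + k)%N => //; rewrite leq_addr.
apply: (@negligible_bigcup _ _ _ P (fun m => \bigcap_k ~` barriers (m + k)%N)) => m.
have mB k : measurable (barriers k) by exact: generated_measurable (@barriers_generated k).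
have mC : measurable (\bigcap_k ~` barriers (m + k)%N).
  by apply: bigcapT_measurable => k; exact: measurableC.
exists (\bigcap_k ~` barriers (m + k)%N); split => //.
apply/eqP; rewrite eq_le measure_ge0 andbT; apply/lee_addgt0Pr => /= e e0.
rewrite add0e.
have := @cvg_expr R (1 - q); rewrite ger0_norm ?subr_ge0// => /(_ ltac:(lra)).
move=> /cvgrPdist_le /(_ e e0)[r _ /(_ r (leqnn r))] /=; rewrite sub0r normrN => hr.
have [g h] := no_barriers_prob m r.
apply: (@le_trans _ _ (P (\bigcap_(i in `I_r) ~` barriers (m + i)%N))).
  apply: le_measure; rewrite ?inE//; first exact: generated_measurable g.
  by move=> w Bw i _; exact: Bw.
rewrite -(fineK (fin_num_measure P _ (generated_measurable g))) lee_fin.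
by apply: (le_trans h); apply: le_trans hr; exact: ler_norm.
Qed.

End blocks.

Lemma all_sites_elliptic : {ae P, forall w, forall x, eps <= omega x w <= 1 - eps}.
Proof.
have N0 : P.-negligible (\bigcup_n (~` [set w | eps <= omega n%:Z w <= 1 - eps] `|`
   ~` [set w | eps <= omega (- n%:Z) w <= 1 - eps])).
  by apply: negligible_bigcup => n; apply: negligibleU; exact: ae_elliptic.
apply: negligibleS N0 => w /= /existsNP[x nx]; exists `|x|%N => //.
have [x0|x0] := leP 0 x; [left|right] => /=.
  by rewrite (_ : `|x|%N%:Z = x)//; lia.
by rewrite (_ : - `|x|%N%:Z = x)//; lia.
Qed.

(** [barrier_after_block] is applied on both sides at each of the infinitely
    many scales where both blocks succeed. The width is polynomial in the
    height [j] and the depth is a small fraction of it, which is what the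
    exponential gains of the Green function estimate can afford. *)
Lemma valleys (a : R) : 0 < a <= 1 ->
  {ae P, forall w, (forall x, eps <= omega x w <= 1 - eps) /\
   forall N : nat, exists j b c : nat, [/\ (N <= j)%N, (b <= j + j ^ 4)%N, (c <= j + j ^ 4)%N,
     j%:R <= potential (omega^~ w) c%:Z /\ j%:R <= potential (omega^~ w) (- b%:Z) &
     forall x : int, - b%:Z <= x <= c%:Z -> - (a * j%:R) <= potential (omega^~ w) x]}.
Proof.
move=> a01; have /andP[a0 a1] := a01.
have [j0 [j00 q_lower]] := block_prob_lower a01.
(* Each explored site moves the potential by at most [logit_bound], so this
   multiple of their number keeps their total below [a j / 2]. *)
pose D := (Num.truncn (2 * logit_bound / a)).+1.
have io := @barriers_infinitely_often a D j0 q_lower a01.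
apply: filterS2 all_sites_elliptic io => w ell bar; split => // N.
have [k Nk [Br Bl]] := bar N.
pose j := scale D j0 k; pose L := start D j0 k.
have kj : (k <= j)%N by rewrite /j /scale leq_addl.
have Lj : (L <= j)%N.
  rewrite /j /scale -/L -addnA; apply: leq_trans (leq_addr _ _).
  exact: leq_pmull.
have j0j : (0 < j)%N by rewrite /j /scale; lia.
have J0 : 0 < j%:R :> R by rewrite ltr0n.
have KL : logit_bound * L%:R <= a / 2 * j%:R.
  have hD : 2 * logit_bound / a <= D%:R by apply: ltW; exact: truncnS_gt.
  rewrite ler_pdivrMr// in hD.
  have hj : D%:R * L%:R <= j%:R :> R.
    by rewrite -natrM ler_nat /j /scale -/L -addnA leq_addr.
  have L0 : 0 <= L%:R :> R by [].
  have h1 := ler_wpM2r L0 hD.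
  by have := ler_wpM2l (ltW a0) hj; rewrite mulrA [a * _]mulrC; lra.
pose u := omega^~ w.
have uE x : log_odds u x = logit (omega x w) by rewrite /log_odds logitE.
pose yr i := log_odds u i.+1%:Z; pose yl i := - log_odds u (- i%:Z).
have yrK i : `|yr i| <= logit_bound by rewrite /yr uE logit_le.
have ylK i : `|yl i| <= logit_bound by rewrite /yl normrN uE logit_le.
pose Yr i w' := 1 * logit (omega (right_site D j0 k i) w').
pose Yl i w' := -1 * logit (omega (left_site D j0 k i) w').
have Yre t : Yr t w = yr (L + t)%N by rewrite /Yr /yr uE mul1r.
have Yle t : Yl t w = yl (L + t)%N by rewrite /Yl /yl uE mulN1r.
have [c [cL hc barc]] := barrier_after_block a01 J0 yrK KL Yre Br.
have [b [bL hb barb]] := barrier_after_block a01 J0 ylK KL Yle Bl.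
exists j, b, c; split => //.
- exact: leq_trans kj.
- by rewrite (leq_trans bL)// leq_add2r.
- by rewrite (leq_trans cL)// leq_add2r.
- by split => //; rewrite potentialN.
move=> x xbc; case: (leP 0 x) => x0.
  by case: x xbc x0 => // n /andP[_ nc] _; exact: barc.
rewrite (_ : x = - `|x|%N%:Z); last by lia.
by rewrite potentialN; apply: barb; lia.
Qed.

End environment.

(** * Divergence of the Green function in a fixed environment *)

Section growth.
Context {R : realType}.

(** The fifth-order term of the exponential series beats the fourth power. *)
Lemma exp_beats_poly (theta B : R) : 1 < theta ->
  exists J : nat, forall j, (J <= j)%N -> B * j%:R ^+ 4 <= theta ^+ j.
Proof.
move=> th1; have th0 : 0 < theta by rewrite (lt_trans ltr01).
have lt0 : 0 < ln theta by rewrite ln_gt0.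
have l5 : 0 < ln theta ^+ 5 by rewrite exprn_gt0.
exists (Num.truncn (B * 120 / ln theta ^+ 5)).+1 => j Jj.
have hj : B * 120 <= j%:R * ln theta ^+ 5.
  rewrite -ler_pdivrMr//; apply/ltW; apply: (lt_le_trans (truncnS_gt _)).
  by rewrite ler_nat.
have -> : theta ^+ j = expR (j%:R * ln theta) by rewrite expRM_natl lnK.
have := @expR_ge1Dxn R (j%:R * ln theta) 4.
rewrite mulr_ge0 ?(ltW lt0)// => /(_ isT); apply: le_trans.
rewrite (_ : 5`! = 120)%N// exprMn.
have j4 : 0 <= j%:R ^+ 4 :> R by rewrite exprn_ge0.
have := ler_wpM2r j4 hj.
rewrite [X in _ + X / _](_ : _ = j%:R * ln theta ^+ 5 * j%:R ^+ 4); last by ring.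
set X := j%:R * _ * _; set Z := j%:R ^+ 4; lra.
Qed.

Lemma geometric_small (q B e : R) : 0 <= q < 1 -> 0 < e ->
  exists J : nat, forall j, (J <= j)%N -> B * q ^+ j <= e.
Proof.
move=> /andP[q0 q1] e0; have := @cvg_expr R q; rewrite ger0_norm// => /(_ q1).
have B0 : 0 < `|B| + 1 by rewrite ltr_wpDl.
move=> /cvgrPdist_le /(_ (e / (`|B| + 1))) [].
  by rewrite divr_gt0.
move=> J _ hJ; exists J => j /hJ /=; rewrite sub0r normrN ger0_norm ?exprn_ge0// => h.
rewrite ler_pdivlMr// mulrC in h; apply: le_trans h.
by rewrite ler_wpM2r ?exprn_ge0// (le_trans (ler_norm B))// lerDl.
Qed.

End growth.

Section quenched.
Context {R : realType} (delta : R) (nu : probability int R) (u : int -> R).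
Context d (T : measurableType d) (P : probability T R).
Variable M : nat -> {mfun T >-> (int * int)%type}.
Hypothesis delta01 : 0 < delta < 1.
Hypothesis u01 : forall x, 0 < u x < 1.
Hypothesis hM_markov : markov_chain P M.
Hypothesis hM_init : P [set t | M 0%N t = (0, 0)] = 1%E.
Hypothesis hM_right : forall x y : int,
  transition_prob P M (x, y) (x + 1, y) (delta * u x).
Hypothesis hM_left : forall x y : int,
  transition_prob P M (x, y) (x - 1, y) (delta * (1 - u x)).
Hypothesis hM_vert : forall x y z : int,
  transition_prob P M (x, y) (x, y + z) ((1 - delta) * fine (nu [set z])).

Let pi x := expR (- potential u x) / u x.

Let pi_gt0 x : 0 < pi x.
Proof. by have /andP[? ?] := u01 x; rewrite divr_gt0 ?expR_gt0. Qed.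

Let pi_balance x : pi x * u x = pi (x + 1) * (1 - u (x + 1)).
Proof.
have /andP[a b] := u01 x; have /andP[a' b'] := u01 (x + 1).
rewrite /pi divfK ?gt_eqF// potentialS opprD expRD mulrAC -mulrA.
rewrite -[LHS]mulr1 -mulrA; congr (_ * _).
by rewrite expRN /log_odds lnK ?posrE ?divr_gt0 ?subr_gt0// mulVf// gt_eqF// divr_gt0// subr_gt0.
Qed.

(** [vertical_le] for [W k y], the probability that [k] further vertical steps
    from [y] end outside [[-m, m]]. *)
Lemma vertical_spread n m (e : R) :
  (forall k, (k <= n)%N ->
     convolution_pow (real_law nu) k (far m%:R) <= e%:E)%E ->
  (P [set t | (m < `|(M n t).2|)%N] <= e%:E)%E.
Proof.
move=> h.
pose W k (y : int) : \bar R :=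
  convolution_pow (real_law nu) k [set x | far m%:R (x + y%:~R)].
have e0 : (0 <= e%:E)%E.
  by apply: le_trans (h 0%N _) => //; exact: measure_ge0.
have mfar y : measurable [set x : R | far m%:R (x + y)].
  rewrite -[X in measurable X]setTI.
  have mp : measurable_fun setT (fun x : R => x + y) by exact: measurable_funD.
  by apply: (mp measurableT (far m%:R)); exact: measurable_far.
have W0 k y : (0 <= W k y)%E by exact: measure_ge0.
have WS k y : W k.+1 y = (\int[nu]_z W k (y + z)%R)%E.
  rewrite /W convolution_pow_shift//; apply: eq_integral => z _; congr (convolution_pow _ _ _).
  by apply/seteqP; split => x /=; rewrite intrD [y%:~R + _]addrC addrA.
have hB k : (0 <= k <= 0 + n)%N -> (W k 0%R <= e%:E)%E.
  move=> /andP[_ kn]; apply: le_trans (h k kn); rewrite /W.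
  rewrite (_ : [set x | _] = far m%:R)//.
  by apply/seteqP; split => x /=; rewrite addr0.
apply: le_trans (vertical_le delta01 u01 hM_markov hM_init hM_right hM_left hM_vert
  W0 e0 WS hB).
rewrite le_eqVlt; apply/orP; left; apply/eqP.
rewrite -(integral_event P M n (fun v => (m < `|v.2|)%N)).
apply: eq_integral => t _; rewrite /W /= diracE /far; congr ((nat_of_bool _)%:R%:E).
have E : [set x : R | m%:R < `|x + (M n t).2%:~R|] 0 = ((m < `|(M n t).2|)%N : Prop).
  by rewrite /= add0r -intr_norm -abszE ltr_nat.
by apply/idP/idP => h'; [rewrite inE; move: h'; rewrite -E|move: h'; rewrite inE -E].
Qed.

(** Take a scale [j] of the environment, [N = n1 2^j] and [m] just above
    [C r^j]. Leaving the valley costs at most [n1 / eps * (2 / e)^j], while the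
    box has at most [5 j^4] columns, [(2 C + 3) r^j] rows, and [pi / pi 0] at
    most [exp (a j) / eps] on it; so [green_lower] makes the Green function
    exceed any constant once [(2 / (r exp a))^j] beats [j^4]. *)
Lemma quenched_green_unbounded (eps a r C : R) (n1 : nat) :
  0 < eps -> (forall x, eps <= u x <= 1 - eps) ->
  0 < C -> 1 <= r -> (0 < n1)%N -> expR a * r < 2 ->
  (forall j k, (k <= n1 * 2 ^ j)%N ->
    (convolution_pow (real_law nu) k (far (C * r ^+ j)) <= 4^-1%:E)%E) ->
  (forall N : nat, exists j b c : nat,
    [/\ (N <= j)%N, (b <= j + j ^ 4)%N, (c <= j + j ^ 4)%N,
      j%:R <= potential u c%:Z /\ j%:R <= potential u (- b%:Z) &
      forall x : int, - b%:Z <= x <= c%:Z -> - (a * j%:R) <= potential u x]) ->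
  forall K : R, exists N, (K%:E <= green P M N)%E.
Proof.
move=> eps0 ueps C0 r1 n10 ar2 spread valley K.
have r0 : 0 < r by rewrite (lt_le_trans ltr01).
have n1R : 0 < n1%:R :> R by rewrite ltr0n.
pose theta : R := 2 / (r * expR a).
have th1 : 1 < theta.
  by rewrite /theta ltr_pdivlMr ?mulr_gt0 ?expR_gt0// mul1r mulrC.
have e2 : 2 < expR 1 :> R by have := @expR_gt1Dx R 1 (oner_neq0 _); lra.
have q01 : 0 <= 2 / (expR 1 : R) < 1.
  by rewrite divr_ge0 ?expR_ge0//= ltr_pdivrMr ?expR_gt0// mul1r.
have [J1 hJ1] := @geometric_small R (2 / expR 1) (n1%:R / eps) 4^-1 q01
  (ltac:(by rewrite invr_gt0)).
pose K' := Num.max K 1.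
have K'0 : 0 < K' by rewrite /K' lt_max ltr01 orbT.
pose B := 4 * K' * (5 * (2 * C + 3)) / (eps * n1%:R).
have [J2 hJ2] := @exp_beats_poly R theta B th1.
have [j [b [c [Nj bj cj [hc hb] hval]]]] := valley (maxn 1 (maxn J1 J2)).
have [j1 [jJ1 jJ2]] : (1 <= j)%N /\ (J1 <= j)%N /\ (J2 <= j)%N.
  by move: Nj; rewrite !geq_max => /and3P[].
exists (n1 * 2 ^ j)%N.
pose m := (Num.truncn (C * r ^+ j)).+1.
pose Q := expR (a * j%:R) / eps.
have pi0E : pi 0 = (u 0)^-1 by rewrite /pi /= oppr0 expR0 div1r.
have pi0_inv x : x / pi 0 = x * u 0 by rewrite pi0E invrK.
have u0 : 0 < u 0 <= 1 by have /andP[? /ltW ->] := u01 0; rewrite andbT.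
have pi_le x v : - v <= potential u x -> pi x <= expR v / eps.
  move=> h; rewrite /pi ler_pM ?expR_ge0//.
  - by rewrite invr_ge0 ltW//; have /andP[] := u01 x.
  - by rewrite ler_expR lerNl.
  - by rewrite lef_pV2 ?posrE//; [have /andP[] := ueps x|have /andP[] := u01 x].
have end_le x : j%:R <= potential u x -> (n1 * 2 ^ j)%:R * (pi x / pi 0) <= 4^-1.
  move=> h; apply: le_trans (hJ1 j jJ1).
  rewrite natrM natrX exprMn exprVn pi0_inv -expRM_natl mulr1.
  have p1 : pi x * u 0 <= expR (- j%:R) / eps.
    have := pi_le x (- j%:R); rewrite opprK => /(_ h) h'.
    have := u0; have := pi_gt0 x; move: h'; set E := _ / eps; nra.
  apply: (le_trans (ler_wpM2l _ p1)); first by rewrite mulr_ge0 ?exprn_ge0.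
  rewrite expRN le_eqVlt; apply/orP; left; apply/eqP; ring.
have rj1 : 1 <= r ^+ j by rewrite exprn_ege1.
have mC : m%:R <= C * r ^+ j + 1.
  rewrite /m -[_.+1]addn1 natrD lerD2r; rewrite truncn_le.
  by rewrite mulr_ge0 ?exprn_ge0// ltW.
have spread_m n : (n < n1 * 2 ^ j)%N ->
    (P [set t | (m < `|(M n t).2|)%N] <= 4^-1%:E)%E.
  move=> nN; apply: vertical_spread => k kn.
  apply: le_trans (spread j k (leq_trans kn (ltnW nN))).
  apply: le_measure; rewrite ?inE; [exact: measurable_far|exact: measurable_far|].
  by move=> x /=; apply: lt_trans; exact: truncnS_gt.
have G := green_lower delta01 u01 hM_markov hM_init hM_right hM_left hM_vert
  pi_gt0 pi_balance (fun x hx => pi_le x _ (hval x hx)) (end_le _ hc) (end_le _ hb)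
  spread_m.
rewrite -/Q in G; set S := (_ * _ * _)%R in G.
have Q0 : 0 < Q by rewrite divr_gt0 ?expR_gt0.
have S0 : 0 < S.
  apply: mulr_gt0; first by apply: mulr_gt0; rewrite ltr0n.
  exact: divr_gt0 Q0 (pi_gt0 0).
have bc_le : (b + c).+1%:R <= 5 * j%:R ^+ 4 :> R.
  rewrite -natrX -natrM ler_nat.
  have : (j <= j ^ 4)%N by rewrite -{1}(expn1 j) leq_pexp2l.
  have : (0 < j ^ 4)%N by rewrite expn_gt0 j1.
  clear -bj cj; lia.
have m_le : m.*2.+1%:R <= (2 * C + 3) * r ^+ j.
  by rewrite -muln2 -addn1 natrD natrM; move: mC rj1; set Z := r ^+ j; lra.
have Q_le : Q / pi 0 <= expR a ^+ j / eps.
  rewrite pi0_inv -expRM_natl [j%:R * a]mulrC -/Q.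
  by have /andP[_ h] := u0; rewrite ler_piMr// ltW.
have S_le : S <= 5 * j%:R ^+ 4 * ((2 * C + 3) * r ^+ j) * (expR a ^+ j / eps).
  rewrite /S ler_pM//; last by rewrite ler_pM.
  by rewrite mulr_ge0 ?invr_ge0 ?ltW.
have key : K' * S <= (n1 * 2 ^ j)%:R / 4.
  apply: (le_trans (ler_wpM2l (ltW K'0) S_le)).
  have re0 : 0 < (r * expR a) ^+ j by rewrite exprn_gt0// mulr_gt0// expR_gt0.
  have := hJ2 j jJ2; rewrite /theta expr_div_n ler_pdivlMr//.
  rewrite exprMn natrM natrX; set E := expR a ^+ j; set Y := j%:R ^+ 4 => h.
  have n14 : 0 <= n1%:R / 4 :> R by rewrite divr_ge0// ltW.
  have := ler_wpM2l n14 h; rewrite [X in _ <= X]mulrAC; apply: le_trans.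
  rewrite le_eqVlt; apply/orP; left; apply/eqP; rewrite /B; field.
  by rewrite !gt_eqF.
have KK : K <= K' by rewrite /K' le_max lexx.
apply: (@le_trans _ _ K'%:E); first by rewrite lee_fin.
have Sinv : (S^-1%:E * ((n1 * 2 ^ j)%:R / 4)%:E <= green P M (n1 * 2 ^ j))%E.
  by rewrite lee_pdivrMl.
apply: le_trans Sinv; rewrite -EFinM lee_fin mulrC ler_pdivlMr//.
Qed.

End quenched.

(** * Recurrence in almost every environment *)

Theorem proposition4p2 (R : realType) (delta : R)
    (hdelta : 0 < delta < 1)
    (d : measure_display) (Omega : measurableType d) (P : probability Omega R)
    (omega : int -> {RV P >-> R})
    (homega01 : forall (x : int) (w : Omega), 0 < omega x w < 1)
    (homega_iid : iid omega)
    (hElogrho :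
      ('E_P[fun w => ln (rho omega 0%R w)] = 0)%E)
    (hVlogrho :
      (0 < 'V_P[fun w => ln (rho omega 0%R w)])%E)
    (eps : R) (heps : 0 < eps < 2^-1)
    (hellipticity :
      P [set w | eps <= omega 0 w <= 1 - eps] = 1%E)
    (nu : probability int R)
    (hnu_integrable : nu.-integrable setT (fun z : int => (z%:~R : R)%:E))
    (hnu_mean : ('E_nu[fun z : int => z%:~R%R] = 0)%E)
    (A : nat -> R) (hA_pos : forall n, 0 < A n)
    (hA_incr : forall m n : nat, (m <= n)%N -> A m <= A n)
    (beta : R) (hbeta : 1 < beta <= 2)
    (mu : probability R R) (hmu : stable beta mu)
    (hcvg : weak_cvg (fun n => normalized_sum_law nu n (A n)) mu)
    (d' : measure_display) (T : measurableType d')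
    (Pq : Omega -> probability T R) (M : nat -> {mfun T >-> (int * int)%type})
    (hM_markov : forall w, markov_chain (Pq w) M)
    (hM_init : forall w, Pq w [set t | M 0%N t = (0, 0)] = 1%E)
    (hM_right : forall w (x y : int),
      transition_prob (Pq w) M (x, y) (x + 1, y) (delta * omega x w))
    (hM_left : forall w (x y : int),
      transition_prob (Pq w) M (x, y) (x - 1, y) (delta * (1 - omega x w)))
    (hM_vert : forall w (x y z : int),
      transition_prob (Pq w) M (x, y) (x, y + z)
        ((1 - delta) * fine (nu [set z]))) :
  {ae P, forall w, recurrent_at (Pq w) M (0, 0)}.
Proof.
have /andP[beta1 _] := hbeta; have /andP[eps0 _] := heps.
have [r [n1 [C [/andP[r1 r2] n10 C0 spread]]]] :=
  vertical_scale hA_pos hA_incr beta1 hmu hcvg.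
have r0 : 0 < r by rewrite (lt_le_trans ltr01).
have l0 : 0 < ln (2 / r) by rewrite ln_gt0// ltr_pdivlMr// mul1r.
(* [a] only has to satisfy [0 < a <= 1] and [exp a < 2 / r]. *)
pose a := Num.min 1 (ln (2 / r) / 2).
have a01 : 0 < a <= 1 by rewrite /a lt_min ltr01 divr_gt0//= ge_min lexx.
have ar2 : expR a * r < 2.
  rewrite -ltr_pdivlMr// -[ltRHS]lnK ?posrE ?divr_gt0// ltr_expR.
  by rewrite /a gt_min ltr_pdivrMr// ltr_pMr// ltr1n orbT.
have := valleys homega01 homega_iid hElogrho hVlogrho heps hellipticity a01.
apply: filterS => w [ell valley].
have u01 x : 0 < omega x w < 1 by exact: homega01.
apply: (green_unbounded_recurrent hdelta u01 (hM_markov w) (hM_init w)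
  (hM_right w) (hM_left w) (hM_vert w)).
exact: (quenched_green_unbounded hdelta u01 (hM_markov w) (hM_init w)
  (hM_right w) (hM_left w) (hM_vert w) eps0 ell C0 r1 n10 ar2 spread valley).
Qed.
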